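(* Let $(M,\{D,J\})$ be a strictly pseudo-convex $CR$-manifold and let $G$ be a Lie subgroup of the group $\mathrm{Aut}_{CR}(M,\{D,J\})$ of $CR$-automorphisms of $M$. For a pseudo-Hermitian structure $\{\omega,J\}$ with $\ker\omega=D$, and $\alpha\in G$, let $u_\alpha\in C^\infty(M,\mathbb{R}^{>0})$ be the function with $\alpha^*\omega=u_\alpha\cdot\omega$, and define $\lambda_{\mathrm{CR}}:G\to C^\infty(M,\mathbb{R}^{>0})$ by $\lambda_{\mathrm{CR}}(\alpha)(x)=u_\alpha(\alpha^{-1}x)$. Then: (1) $\lambda_{\mathrm{CR}}$ is a differentiable one-cocycle, and its class $$\mu_{\mathrm{CR}}=[\lambda_{\mathrm{CR}}]\in H^1_d\left(G,C^\infty(M,\mathbb{R}^{>0})\right)$$ is induced by the $CR$-structure on $M$, i.e. it does not depend on the choice of the compatible contact form $\omega$. (2) The class $\mu_{\mathrm{CR}}$ vanishes if and only if there exists a contact form $\eta$ compatible with the $CR$-structure such that $G$ is contained in the group of pseudo-Hermitian transformations $\mathrm{Psh}(M,\{\eta,J\})$.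
   Context: A pseudo-Hermitian structure $\{\omega,J\}$ on a connected smooth manifold $M$ consists of a contact form $\omega$ and a complex structure $J$ on $\ker\omega$ such that the Levi form $d\omega(J\cdot,\cdot)$ is a positive definite Hermitian form on $\ker\omega$. A strictly pseudo-convex $CR$-structure is a pair $\{D,J\}$ with $D=\ker\omega$ induced by a pseudo-Hermitian structure $\{\omega,J\}$; a contact form $\eta$ is compatible if $\{\eta,J\}$ is pseudo-Hermitian with $\ker\eta=D$. For every $\alpha\in\mathrm{Aut}_{CR}(M,\{D,J\})$ one has $\alpha^*\omega=u_\alpha\omega$ with a positive smooth function $u_\alpha$. $\mathrm{Psh}(M,\{\omega,J\})=\{\alpha\in\mathrm{Diff}(M)\mid\alpha^*\omega=\omega,\ \alpha_*\circ J=J\circ\alpha_*|_D\}$ and $\mathrm{Aut}_{CR}(M,\{D,J\})=\{\alpha\in\mathrm{Diff}(M)\mid\alpha_*D=D,\ \alpha_*\circ J=J\circ\alpha_*|_D\}$ (a Lie group). $C^\infty(M,\mathbb{R}^{>0})$ is the multiplicative group of positive smooth functions with the $C^\infty$-topology and $G$-action $(\alpha\cdot f)(x)=f(\alpha^{-1}x)$; via $\exp$ it is isomorphic to the differentiable $G$-module $C^\infty(M,\mathbb{R})$. A differentiable one-cocycle (crossed homomorphism) is a smooth map $\lambda:G\to C^\infty(M,\mathbb{R}^{>0})$ with $\lambda(\alpha\beta)(x)=\lambda(\beta)(\alpha^{-1}x)\cdot\lambda(\alpha)(x)$. $H^1_d(G,C^\infty(M,\mathbb{R}^{>0}))$ is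 the group of differentiable one-cocycles modulo those of the form $\lambda(\alpha)(x)=v(\alpha^{-1}x)\,v(x)^{-1}$ with $v\in C^\infty(M,\mathbb{R}^{>0})$. *)

(* Defs.v *)
From HB Require Import structures.
From mathcomp Require Import all_boot all_order all_algebra perm.
From mathcomp Require Import all_classical all_reals all_analysis.

Set Implicit Arguments.
Unset Strict Implicit.
Unset Printing Implicit Defensive.

Import Order.TTheory GRing.Theory Num.Theory.
Import numFieldNormedType.Exports.

Local Open Scope classical_set_scope.
Local Open Scope ring_scope.

(** * Smooth maps between open subsets of R^n *)

(** [Ck k U f] is meant for [U] open, since ['D_v f] uses values of [f] on
    a neighbourhood of the point. *)
Fixpoint Ck (R : realType) (n : nat) (V : normedModType R) (k : nat)
    (U : set 'rV[R]_n) (f : 'rV[R]_n -> V) : Prop :=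
  (forall x, U x -> {for x, continuous f}) /\
  match k with
  | 0 => True
  | k'.+1 => forall v : 'rV[R]_n,
      (forall x, U x -> derivable f x v) /\ Ck k' U (fun x => 'D_v f x)
  end.

Definition smooth_on (R : realType) (n : nat) (V : normedModType R)
    (U : set 'rV[R]_n) (f : 'rV[R]_n -> V) : Prop :=
  forall k, Ck k U f.

(** * Smooth manifolds *)

(** [cinv] is only meaningful on [cmap @` cdom]. *)
Record chart (R : realType) (T : Type) (n : nat) := Chart {
  cdom : set T;
  cmap : T -> 'rV[R]_n;
  cinv : 'rV[R]_n -> T }.

Definition cimg (R : realType) (T : Type) (n : nat) (c : chart R T n)
    (U : set T) : set 'rV[R]_n :=
  cmap c @` (cdom c `&` U).

(** An atlas comes with a chosen chart around each point.  The tangent space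
    at [p] is ['rV[R]_n], a tangent vector being given by its coordinates in
    the chart [chart_at p]. *)
Record atlas (R : realType) (T : Type) (n : nat) := Atlas {
  charts : set (chart R T n);
  chart_at : T -> chart R T n }.

Definition is_chart (R : realType) (T : topologicalType) (n : nat)
    (c : chart R T n) : Prop :=
  [/\ open (cdom c), open (cimg c setT),
      forall x, cdom c x -> {for x, continuous (cmap c)} &
      forall x, cdom c x -> cinv c (cmap c x) = x] /\
  (forall y, cimg c setT y -> {for y, continuous (cinv c)}).

Definition smooth_manifold (R : realType) (T : topologicalType) (n : nat)
    (A : atlas R T n) : Prop :=
  [/\ hausdorff_space T, @second_countable T,
      forall c, charts A c -> is_chart c,
      forall x, charts A (chart_at A x) /\ cdom (chart_at A x) x &
      forall c d, charts A c -> charts A d ->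
        smooth_on (cimg c (cdom d)) (cmap d \o cinv c)].

Definition prod_chart (R : realType) (S T : Type) (m n : nat)
    (c : chart R S m) (d : chart R T n) : chart R (S * T)%type (m + n) :=
  Chart (cdom c `*` cdom d)
        (fun z => row_mx (cmap c z.1) (cmap d z.2))
        (fun y => (cinv c (lsubmx y), cinv d (rsubmx y))).

Definition prod_atlas (R : realType) (S T : Type) (m n : nat)
    (A : atlas R S m) (B : atlas R T n) : atlas R (S * T)%type (m + n) :=
  Atlas [set e | exists c d,
           [/\ charts A c, charts B d & e = prod_chart c d]]
        (fun z => prod_chart (chart_at A z.1) (chart_at B z.2)).

Definition smooth_map (R : realType) (S T : topologicalType) (m n : nat)
    (A : atlas R S m) (B : atlas R T n) (f : S -> T) : Prop :=
  continuous f /\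
  forall c d, charts A c -> charts B d ->
    smooth_on (cimg c (f @^-1` cdom d)) (cmap d \o f \o cinv c).

Definition smooth_fun (R : realType) (T : Type) (n : nat)
    (A : atlas R T n) (f : T -> R) : Prop :=
  forall c, charts A c -> smooth_on (cimg c setT) (f \o cinv c).

Definition diffeo (R : realType) (T : topologicalType) (n : nat)
    (A : atlas R T n) (f : T -> T) : Prop :=
  smooth_map A A f /\
  exists g, [/\ smooth_map A A g, cancel f g & cancel g f].

(** The tangent map [f_*] at [p], in the charts chosen at [p] and [f p]. *)
Definition tangent_map (R : realType) (S T : Type) (m n : nat)
    (A : atlas R S m) (B : atlas R T n) (f : S -> T) (p : S)
    (v : 'rV[R]_m) : 'rV[R]_n :=
  'D_v (cmap (chart_at B (f p)) \o f \o cinv (chart_at A p))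
       (cmap (chart_at A p) p).

(** * Vector fields and one-forms *)

Definition field_in_chart (R : realType) (T : Type) (n : nat)
    (A : atlas R T n) (X : T -> 'rV[R]_n) (c : chart R T n)
    (y : 'rV[R]_n) : 'rV[R]_n :=
  let p := cinv c y in
  'D_(X p) (cmap c \o cinv (chart_at A p)) (cmap (chart_at A p) p).

Definition smooth_field (R : realType) (T : Type) (n : nat)
    (A : atlas R T n) (U : set T) (X : T -> 'rV[R]_n) : Prop :=
  forall c, charts A c -> smooth_on (cimg c U) (field_in_chart A X c).

Definition form_in_chart (R : realType) (T : Type) (n : nat)
    (A : atlas R T n) (w : T -> 'rV[R]_n -> R) (c : chart R T n)
    (y v : 'rV[R]_n) : R :=
  let p := cinv c y in w p ('D_v (cmap (chart_at A p) \o cinv c) y).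

Definition smooth_form (R : realType) (T : Type) (n : nat)
    (A : atlas R T n) (w : T -> 'rV[R]_n -> R) : Prop :=
  (forall p (a : R) (u v : 'rV[R]_n), w p (a *: u + v) = a * w p u + w p v) /\
  (forall c, charts A c -> forall v,
     smooth_on (cimg c setT) (fun y => form_in_chart A w c y v)).

Definition pullback (R : realType) (T : Type) (n : nat)
    (A : atlas R T n) (f : T -> T) (w : T -> 'rV[R]_n -> R) :
    T -> 'rV[R]_n -> R :=
  fun p v => w (f p) (tangent_map A A f p v).

(** [(dw)_p(u, v) = u(w(v)) - v(w(u))] for [u], [v] extended to constant
    fields in the chart chosen at [p]. *)
Definition ext_deriv (R : realType) (T : Type) (n : nat)
    (A : atlas R T n) (w : T -> 'rV[R]_n -> R) (p : T) (u v : 'rV[R]_n) : R :=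
  let c := chart_at A p in
  'D_u (fun y => form_in_chart A w c y v) (cmap c p) -
  'D_v (fun y => form_in_chart A w c y u) (cmap c p).

Definition ker_form (R : realType) (T : Type) (n : nat)
    (w : T -> 'rV[R]_n -> R) (p : T) : set 'rV[R]_n :=
  [set v | w p v = 0].

(** The value of [w /\ (dw)^m] on [(e_0, ..., e_2m)], up to a nonzero
    combinatorial constant. *)
Definition contact_volume (R : realType) (T : Type) (m : nat)
    (A : atlas R T m.*2.+1) (w : T -> 'rV[R]_(m.*2.+1) -> R) (p : T)
    (e : 'I_(m.*2.+1) -> 'rV[R]_(m.*2.+1)) : R :=
  \sum_(s : 'S_(m.*2.+1)) (-1) ^+ s * w p (e (s ord0)) *
    \prod_(i < m) ext_deriv A w p (e (s (inord i.*2.+1)))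
                                  (e (s (inord i.*2.+2))).

Definition contact_form (R : realType) (T : Type) (m : nat)
    (A : atlas R T m.*2.+1) (w : T -> 'rV[R]_(m.*2.+1) -> R) : Prop :=
  smooth_form A w /\ forall p, exists e, contact_volume A w p e != 0.

(** * Pseudo-Hermitian and CR structures *)

(** [J p] is defined on the whole tangent space for convenience; only its
    restriction to [D p] is ever used. *)
Definition complex_structure (R : realType) (T : topologicalType) (n : nat)
    (A : atlas R T n) (D : T -> set 'rV[R]_n)
    (J : T -> 'rV[R]_n -> 'rV[R]_n) : Prop :=
  [/\ forall p u, D p u -> D p (J p u),
      forall p (a : R) u v, D p u -> D p v ->
        J p (a *: u + v) = a *: J p u + J p v,
      forall p u, D p u -> J p (J p u) = - u &
      forall (U : set T) (X : T -> 'rV[R]_n), open U ->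
        smooth_field A U X -> (forall p, U p -> D p (X p)) ->
        smooth_field A U (fun p => J p (X p))].

Definition positive_hermitian (R : realType) (n : nat)
    (D : set 'rV[R]_n) (J : 'rV[R]_n -> 'rV[R]_n)
    (L : 'rV[R]_n -> 'rV[R]_n -> R) : Prop :=
  [/\ forall u v, D u -> D v -> L u v = L v u,
      forall u v, D u -> D v -> L (J u) (J v) = L u v &
      forall u, D u -> u != 0 -> 0 < L u u].

Definition pseudo_hermitian (R : realType) (T : topologicalType) (m : nat)
    (A : atlas R T m.*2.+1) (w : T -> 'rV[R]_(m.*2.+1) -> R)
    (J : T -> 'rV[R]_(m.*2.+1) -> 'rV[R]_(m.*2.+1)) : Prop :=
  [/\ contact_form A w, complex_structure A (ker_form w) J &
      forall p, positive_hermitian (ker_form w p) (J p)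
                  (fun u v => ext_deriv A w p (J p u) v)].

Definition compatible (R : realType) (T : topologicalType) (m : nat)
    (A : atlas R T m.*2.+1) (D : T -> set 'rV[R]_(m.*2.+1))
    (J : T -> 'rV[R]_(m.*2.+1) -> 'rV[R]_(m.*2.+1))
    (w : T -> 'rV[R]_(m.*2.+1) -> R) : Prop :=
  pseudo_hermitian A w J /\ forall p, ker_form w p = D p.

Definition strictly_pseudoconvex_CR (R : realType) (T : topologicalType)
    (m : nat) (A : atlas R T m.*2.+1) (D : T -> set 'rV[R]_(m.*2.+1))
    (J : T -> 'rV[R]_(m.*2.+1) -> 'rV[R]_(m.*2.+1)) : Prop :=
  exists w, compatible A D J w.

Definition commutes_with_J (R : realType) (T : Type) (n : nat)
    (A : atlas R T n) (D : T -> set 'rV[R]_n)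
    (J : T -> 'rV[R]_n -> 'rV[R]_n) (f : T -> T) : Prop :=
  forall p v, D p v ->
    tangent_map A A f p (J p v) = J (f p) (tangent_map A A f p v).

Definition Aut_CR (R : realType) (T : topologicalType) (n : nat)
    (A : atlas R T n) (D : T -> set 'rV[R]_n)
    (J : T -> 'rV[R]_n -> 'rV[R]_n) : set (T -> T) :=
  [set f | [/\ diffeo A f, forall p, tangent_map A A f p @` D p = D (f p) &
               commutes_with_J A D J f]].

Definition Psh (R : realType) (T : topologicalType) (n : nat)
    (A : atlas R T n) (w : T -> 'rV[R]_n -> R)
    (J : T -> 'rV[R]_n -> 'rV[R]_n) : set (T -> T) :=
  [set f | [/\ diffeo A f, pullback A f w = w &
               commutes_with_J A (ker_form w) J f]].

(** * Lie groups *)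

(** No compatibility between the two structures is built in; it is part of
    [lie_group]. *)
HB.structure Definition TopologicalCarrierGroup :=
  {G of Group G & Topological G}.

Notation topCarrierGroupType := TopologicalCarrierGroup.type.

Definition lie_group (R : realType) (G : topCarrierGroupType) (k : nat)
    (A : atlas R G k) : Prop :=
  [/\ smooth_manifold A,
      smooth_map (prod_atlas A A) A (fun z : G * G => (z.1 * z.2)%g) &
      smooth_map A A (fun g : G => (g^-1)%g)].

(** [G] with its smooth structure [A] is the group [S] of transformations of
    [T], equipped with a Lie group structure for which the evaluation
    [G * T -> T] is smooth (a Lie transformation group).  By second
    countability there is at most one such structure on [S]. *)
Definition lie_transformation_group (R : realType) (G : topCarrierGroupType)
    (T : topologicalType) (k n : nat) (A : atlas R G k) (B : atlas R T n)
    (S : set (T -> T)) (ev : G -> T -> T) : Prop :=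
  [/\ lie_group A, injective ev, range ev = S,
      forall g h x, ev (g * h)%g x = ev g (ev h x) &
      smooth_map (prod_atlas A B) B (fun z : G * T => ev z.1 z.2)].

(** Lie subgroups are immersed, not necessarily closed. *)
Definition lie_subgroup (R : realType) (G H : topCarrierGroupType)
    (k l : nat) (A : atlas R G k) (B : atlas R H l) (iota : G -> H) : Prop :=
  [/\ lie_group A, {morph iota : g h / (g * h)%g}, injective iota,
      smooth_map A B iota & forall g, injective (tangent_map A B iota g)].

(** * The Frechet space of smooth functions *)

Definition iter_deriv (R : realType) (n : nat) (s : seq 'rV[R]_n)
    (f : 'rV[R]_n -> R) : 'rV[R]_n -> R :=
  foldr (fun v g => fun x => 'D_v g x) f s.

(** Convergence in the C^oo-topology: uniform convergence of all iterated
    partial derivatives on the compact subsets of the chart images. *)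
Definition Cinfty_cvg (R : realType) (T : Type) (n : nat)
    (A : atlas R T n) (F : set_system (T -> R)) (f : T -> R) : Prop :=
  forall (c : chart R T n) (s : seq 'rV[R]_n), charts A c ->
    {family (fun K : set 'rV[R]_n => compact K /\ K `<=` cimg c setT),
      (fun g : T -> R => iter_deriv s (g \o cinv c)) @ F
        --> iter_deriv s (f \o cinv c)}.

(** Differentiability of maps into the locally convex space of smooth
    functions, through iterated directional derivatives that exist and are
    continuous for the C^oo-topology. *)
Fixpoint Cinfty_Ck (R : realType) (T : Type) (n : nat) (A : atlas R T n)
    (d k : nat) (U : set 'rV[R]_d) (h : 'rV[R]_d -> T -> R) : Prop :=
  (forall y, U y -> smooth_fun A (h y) /\ Cinfty_cvg A (h @ y) (h y)) /\
  match k with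
  | 0 => True
  | k'.+1 => forall v : 'rV[R]_d, exists h' : 'rV[R]_d -> T -> R,
      (forall y, U y ->
        Cinfty_cvg A
          ((fun (t : R) (x : T) => t^-1 * (h (y + t *: v) x - h y x)) @ 0^')
          (h' y)) /\
      Cinfty_Ck A k' U h'
  end.

Definition smooth_into_Cinfty (R : realType) (S T : Type) (d n : nat)
    (B : atlas R S d) (A : atlas R T n) (F : S -> T -> R) : Prop :=
  forall c, charts B c ->
    forall k, Cinfty_Ck A k (cimg c setT) (F \o cinv c).

(** Elements of C^oo(M, R^{>0}). *)
Definition positive_smooth_fun (R : realType) (T : Type) (n : nat)
    (A : atlas R T n) (f : T -> R) : Prop :=
  smooth_fun A f /\ forall x, 0 < f x.

(** * Differentiable cohomology with values in C^oo(M, R^{>0}) *)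

Section Cohomology.
Context (R : realType) (G : topCarrierGroupType) (T : topologicalType).
Context (k n : nat) (B : atlas R G k) (A : atlas R T n) (act : G -> T -> T).

(** The smooth structure on C^oo(M, R^{>0}) is the one transported from
    C^oo(M, R) by [exp]. *)
Definition Z1d : set (G -> T -> R) :=
  [set l | [/\ forall g, positive_smooth_fun A (l g),
      smooth_into_Cinfty B A (fun g x => ln (l g x)) &
      forall g h x, l (g * h)%g x = l h (act g^-1%g x) * l g x]].

Definition B1d : set (G -> T -> R) :=
  [set l | Z1d l /\ exists2 v, positive_smooth_fun A v &
      l = (fun g x => v (act g^-1%g x) * (v x)^-1)].

(** The coset [l * B1d]. *)
Definition H1d_class (l : G -> T -> R) : set (G -> T -> R) :=
  [set l' | exists2 b, B1d b & l' = (fun g x => l g x * b g x)].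

Definition H1d : set (set (G -> T -> R)) := H1d_class @` Z1d.

Definition H1d_zero : set (G -> T -> R) := H1d_class (fun _ _ => 1).

(** [u g] is the function with [g^* w = u g * w]. *)
Definition conformal_factor (w : T -> 'rV[R]_n -> R) (u : G -> T -> R) : Prop :=
  forall g, positive_smooth_fun A (u g) /\
    pullback A (act g) w = (fun x v => u g x * w x v).

Definition lambda_CR (u : G -> T -> R) : G -> T -> R :=
  fun g x => u g (act g^-1%g x).

End Cohomology.

(* Main.v *)
Require Import Defs.
From mathcomp Require Import all_boot all_order all_algebra perm.
From mathcomp Require Import all_classical all_reals all_analysis.
From mathcomp Require Import ring zify.
Set Implicit Arguments.
Unset Strict Implicit.
Unset Printing Implicit Defensive.
Import Order.TTheory GRing.Theory Num.Theory.
Import numFieldNormedType.Exports.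
Local Open Scope classical_set_scope.
Local Open Scope ring_scope.

(** Functoriality of the pullback gives the cocycle identity
    [u_(gh) = (u_g o h) u_h], hence [lambda_CR g = 1 / u_(g^-1)].  In charts [u_(g^-1) x]
    is a quotient whose numerator evaluates [w] on the spatial derivative of
    [(g, x) |-> g^-1 x], so it is smooth in [(g, x)] jointly; a jointly smooth function is a
    smooth map into the Frechet space [C^oo(M, R)].  Two compatible forms satisfy
    [w' = f w] with [f] nowhere zero, and their cocycles then differ by the coboundary of
    [1 / |f|].  If [lambda_CR] is the coboundary of [v], then [eta = v w] is invariant, and it is
    again a compatible contact form because [eta /\ (d eta)^m = v^(m+1) w /\ (dw)^m] and the
    Levi form of [eta] is [v] times that of [w]. *)

(** * Calculus on open subsets of R^n *)

Section Calculus.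
Context {R : realType}.

(** Two obstacles shape the development. First, [Ck] only provides iterated directional derivatives
    that exist and are continuous; linearity in the direction, the chain rule and the symmetry of
    second derivatives are all extracted from the mean value theorem along segments. Second, a
    conformal factor is given as a smooth function of [x] for each [g] separately, and nothing in
    its definition ties together the values at different [g]. Its regularity in [g] is recovered
    from the equation [g^* w = u_g w], which determines [u_g] because a contact form vanishes at no
    point.

    In the conformal change, [d (v w) = v dw + dv /\ w]. The extra term [dv /\ w] disappears from
    the volume because [w /\ w = 0], and from the Levi form because both arguments lie in the kernel
    of [w]. The remaining implication, from an invariant compatible form to a vanishing class,
    follows from independence of the form: an invariant form has conformal factor [1], hence the
    trivial cocycle. *)

Lemma near_eq_continuous (T U : topologicalType) (f g : T -> U) (x : T) :
  (\near x, f x = g x) -> {for x, continuous g} -> {for x, continuous f}.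
Proof.
move=> fg cg; rewrite /prop_for /continuous_at (nbhs_singleton fg).
apply: cvg_trans cg; apply: near_eq_cvg.
by near=> y; apply/esym; near: y.
Unshelve. all: by end_near. Qed.

Lemma Ck_continuous n (V : normedModType R) k U (f : 'rV[R]_n -> V) x :
  Ck k U f -> U x -> {for x, continuous f}.
Proof. by case: k => [|k] [h _]; apply: h. Qed.

Lemma Ck_derivable n (V : normedModType R) k U (f : 'rV[R]_n -> V) x v :
  Ck k.+1 U f -> U x -> derivable f x v.
Proof. by move=> [_ /(_ v)[h _]]; apply: h. Qed.

Lemma Ck_derive n (V : normedModType R) k U (f : 'rV[R]_n -> V) v :
  Ck k.+1 U f -> Ck k U (fun x => 'D_v f x).
Proof. by move=> [_ /(_ v)[]]. Qed.

Lemma CkW n (V : normedModType R) k U (f : 'rV[R]_n -> V) :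
  Ck k.+1 U f -> Ck k U f.
Proof.
elim: k f => [|k IH] f fU.
  by split=> // x Ux; exact: Ck_continuous fU Ux.
split=> [x Ux|v]; first exact: Ck_continuous fU Ux.
split; first by move=> x; exact: Ck_derivable fU.
exact/IH/Ck_derive.
Qed.

(** Continuity and directional derivatives depend only on the germ, so the comparison function may
    change from point to point. This later allows a chart, or a field on which a form does not
    vanish, to be chosen around each point. *)
Lemma Ck_near n (V : normedModType R) k U (f : 'rV[R]_n -> V) :
  (forall x, U x -> exists g W,
     [/\ open W, W x, Ck k W g & forall y, W y -> f y = g y]) ->
  Ck k U f.
Proof.
elim: k f => [|k IH] f fU.
  split=> // x /fU[g [W [oW Wx gW fg]]].
  apply: (@near_eq_continuous _ _ _ g); last exact: Ck_continuous gW Wx.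
  by apply: filterS (open_nbhs_nbhs (conj oW Wx)).
split.
  move=> x /fU[g [W [oW Wx gW fg]]].
  apply: (@near_eq_continuous _ _ _ g); last exact: Ck_continuous gW Wx.
  by apply: filterS (open_nbhs_nbhs (conj oW Wx)).
move=> v; split.
  move=> x /fU[g [W [oW Wx gW fg]]].
  apply: (@near_eq_derivable _ _ _ g); last exact: Ck_derivable gW Wx.
  by apply: filterS (open_nbhs_nbhs (conj oW Wx)) => y /fg.
apply: IH => x /fU[g [W [oW Wx gW fg]]].
exists (fun y => 'D_v g y), W; split => //; first exact: Ck_derive gW.
move=> y Wy; apply: near_eq_derive.
exact: filterS fg (open_nbhs_nbhs (conj oW Wy)).
Qed.

Lemma Ck_ext n (V : normedModType R) k U (f g : 'rV[R]_n -> V) :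
  open U -> (forall x, U x -> f x = g x) -> Ck k U g -> Ck k U f.
Proof. by move=> oU fg gU; apply: Ck_near => x Ux; exists g, U. Qed.

Lemma CkS n (V : normedModType R) k U W (f : 'rV[R]_n -> V) :
  W `<=` U -> Ck k U f -> Ck k W f.
Proof.
move=> WU; elim: k f => [|k IH] f [fc fd]; split; try by [move=> x /WU; exact: fc].
  by [].
move=> v.
by have [df Df] := fd v; split; [move=> x /WU; exact: df|exact: IH].
Qed.

Lemma Ck_cst n (V : normedModType R) k U (c : V) : Ck k U (fun _ : 'rV[R]_n => c).
Proof.
elim: k c => [|k IH] c; first by split=> // x _; apply: cst_continuous.
split=> [x _|v]; first by apply: cst_continuous.
split=> [x _|]; first exact: derivable_cst.
have -> : (fun x : 'rV[R]_n => 'D_v (fun=> c) x) = (fun=> 0).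
  by apply/funext => x; exact: derive_cst.
exact: IH.
Qed.

Lemma CkD n k (U : set 'rV[R]_n) (f g : 'rV[R]_n -> R) : open U ->
  Ck k U f -> Ck k U g -> Ck k U (fun x => f x + g x).
Proof.
move=> oU; elim: k f g => [|k IH] f g fU gU.
  split=> // x Ux.
  exact: (cvgD (Ck_continuous fU Ux) (Ck_continuous gU Ux)).
split=> [x Ux|v].
  exact: (cvgD (Ck_continuous fU Ux) (Ck_continuous gU Ux)).
split=> [x Ux|].
  by apply: (@derivableD _ _ _ f g); [exact: Ck_derivable fU Ux|exact: Ck_derivable gU Ux].
apply: (@Ck_ext _ _ _ _ _ (fun x => 'D_v f x + 'D_v g x)) => // [x Ux|].
  by apply: (@deriveD _ _ _ f g); [exact: Ck_derivable fU Ux|exact: Ck_derivable gU Ux].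
by apply: IH; exact: Ck_derive.
Qed.

Lemma CkM n k (U : set 'rV[R]_n) (f g : 'rV[R]_n -> R) : open U ->
  Ck k U f -> Ck k U g -> Ck k U (fun x => f x * g x).
Proof.
move=> oU; elim: k f g => [|k IH] f g fU gU.
  split=> // x Ux.
  exact: (cvgM (Ck_continuous fU Ux) (Ck_continuous gU Ux)).
split=> [x Ux|v].
  exact: (cvgM (Ck_continuous fU Ux) (Ck_continuous gU Ux)).
split=> [x Ux|].
  by apply: (@derivableM _ _ f g); [exact: Ck_derivable fU Ux|exact: Ck_derivable gU Ux].
apply: (@Ck_ext _ _ _ _ _ (fun x => f x * 'D_v g x + g x * 'D_v f x)) => // [x Ux|].
  by apply: (@deriveM _ _ f g); [exact: Ck_derivable fU Ux|exact: Ck_derivable gU Ux].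
by apply: CkD => //; apply: IH; by [exact: CkW|exact: Ck_derive].
Qed.

Lemma CkN n k (U : set 'rV[R]_n) (f : 'rV[R]_n -> R) : open U ->
  Ck k U f -> Ck k U (fun x => - f x).
Proof.
move=> oU fU; apply: (@Ck_ext _ _ _ _ _ (fun x => -1 * f x)) => // [x _|].
  by rewrite mulN1r.
by apply: CkM => //; exact: Ck_cst.
Qed.

Lemma Ck_sum n k (U : set 'rV[R]_n) (I : Type) (r : seq I) (f : I -> 'rV[R]_n -> R) : open U ->
  (forall i, Ck k U (f i)) -> Ck k U (fun x => \sum_(i <- r) f i x).
Proof.
move=> oU fU; elim: r => [|i r IH].
  by apply: (@Ck_ext _ _ _ _ _ (fun=> 0)) => [//|x _|]; [rewrite big_nil|exact: Ck_cst].
apply: (@Ck_ext _ _ _ _ _ (fun x => f i x + \sum_(i <- r) f i x)) => // [x _|].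
  by rewrite big_cons.
exact: CkD.
Qed.

Lemma CkV n k (U : set 'rV[R]_n) (f : 'rV[R]_n -> R) : open U -> (forall x, U x -> f x != 0) ->
  Ck k U f -> Ck k U (fun x => (f x)^-1).
Proof.
move=> oU f0; elim: k => [|k IH] fU.
  by split=> // x Ux; exact: (cvgV (f0 _ Ux) (Ck_continuous fU Ux)).
split=> [x Ux|v].
  exact: (cvgV (f0 _ Ux) (Ck_continuous fU Ux)).
split=> [x Ux|].
  by apply: derivableV; [exact: f0|exact: Ck_derivable fU Ux].
apply: (@Ck_ext _ _ _ _ _ (fun x => - ((f x)^-1 * (f x)^-1) * 'D_v f x)) => // [x Ux|].
  rewrite deriveV ?f0//; last exact: Ck_derivable fU Ux.
  by rewrite -exprVn expr2.
apply: CkM => //; last exact: Ck_derive.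
by apply: CkN => //; apply: CkM => //; apply: IH; exact: CkW.
Qed.

(** The difference quotients on the two sides are the same functions of [h]; this brings
    one-variable calculus to directional derivatives. *)
Lemma is_derive_line n (V : normedModType R) (f : 'rV[R]_n -> V) x v (t : R) :
  derivable f (t *: v + x) v ->
  is_derive t 1 (fun s : R => f (s *: v + x)) ('D_v f (t *: v + x)).
Proof.
move=> df; have E : (fun h : R => h^-1 *: (((fun s : R => f (s *: v + x)) \o shift t) (h *: 1)
    - f (t *: v + x))) =
    (fun h : R => h^-1 *: ((f \o shift (t *: v + x)) (h *: v) - f (t *: v + x))).
  apply/funext => h /=; congr (_ *: (f _ - _)).
  by rewrite [h *: 1]mulr1 scalerDl addrA.
by split; rewrite /derivable /derive E.
Qed.

Lemma continuous_line n (V : normedModType R) (f : 'rV[R]_n -> V) (x v : 'rV[R]_n) :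
  derivable f x v -> (fun t : R => f (t *: v + x)) @ (0 : R) --> f x.
Proof.
move=> df.
have := @is_derive_line _ _ f x v 0; rewrite scale0r add0r => /(_ df)[h _].
have /derivable1_diffP/differentiable_continuous := h.
by rewrite /prop_for /continuous_at scale0r add0r.
Qed.

Lemma derive_mvt n (f : 'rV[R]_n -> R) (x v : 'rV[R]_n) :
  (forall t : R, 0 <= t <= 1 -> derivable f (t *: v + x) v) ->
  exists2 t : R, 0 <= t <= 1 & f (v + x) - f x = 'D_v f (t *: v + x).
Proof.
move=> df; pose phi (t : R) := f (t *: v + x).
have dphi (t : R) : t \in `[0, 1]%R -> is_derive t 1 phi ('D_v f (t *: v + x)).
  by rewrite in_itv/= => t01; apply: is_derive_line; exact: df.
have dphi' (t : R) : t \in `]0, 1[%R -> is_derive t 1 phi ('D_v f (t *: v + x)).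
  by move=> t01; apply: dphi; exact: subset_itv_oo_cc t01.
have cphi : {within `[0, 1], continuous phi}.
  by apply: derivable_within_continuous => t /dphi[].
have [t t01 E] := @MVT_segment R phi (fun t => 'D_v f (t *: v + x)) 0 1 ler01 dphi' cphi.
exists t; first by move: t01; rewrite in_itv.
by move: E; rewrite /phi subr0 mulr1 scale1r scale0r add0r.
Qed.


(** Along the line, [f] becomes a function [phi] of one variable, where derivability already gives a
    linear differential; the case [a = 0] is included. *)
Lemma is_derive_scale_dir n (V : normedModType R) (f : 'rV[R]_n -> V) (x v : 'rV[R]_n) (a : R) :
  derivable f x v -> is_derive x (a *: v) f (a *: 'D_v f x).
Proof.
move=> df; pose phi (t : R) := f (t *: v + x).
have dphi : is_derive (0 : R) 1 phi ('D_v f x).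
  by have := @is_derive_line _ _ f x v 0; rewrite scale0r add0r => /(_ df).
have /derivable1_diffP diffphi : derivable phi 0 1 by case: dphi.
have E : (fun h : R => h^-1 *: ((phi \o shift 0) (h *: a) - phi 0)) =
    (fun h => h^-1 *: ((f \o shift x) (h *: (a *: v)) - f x)).
  apply/funext => h /=; rewrite /phi addr0 scale0r add0r.
  by rewrite scalerA.
have := diff_derivable (v := a) diffphi; rewrite /derivable E => da.
split=> //; have -> : 'D_(a *: v) f x = 'D_a phi 0 by rewrite /derive E.
rewrite deriveE// -[X in 'd _ _ X](mulr1 a) linearZ/= -deriveE//.
by have [_ ->] := dphi.
Qed.

Lemma derive_scale_dir n (f : 'rV[R]_n -> R) (x v : 'rV[R]_n) (a : R) :
  derivable f x v -> 'D_(a *: v) f x = a * 'D_v f x.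
Proof. by move=> /is_derive_scale_dir-/(_ a)[]. Qed.

Lemma near0_ball n (U : set 'rV[R]_n) (x : 'rV[R]_n) (C : R) : nbhs x U ->
  \forall t \near (0 : R)^', forall z : 'rV[R]_n, `|z - x| <= C * `|t| -> U z.
Proof.
move=> /nbhs_ballP[d /= d0 dU].
have [C0|C0] := leP C 0.
  near=> t => z zx.
  apply: dU; rewrite -ball_normE/= distrC (le_lt_trans zx)//.
  by rewrite (le_lt_trans _ d0)// mulr_le0_ge0.
near=> t => z zx.
apply: dU; rewrite -ball_normE/= distrC (le_lt_trans zx)//.
rewrite mulrC -ltr_pdivlMr//.
by near: t; apply: dnbhs0_lt; rewrite divr_gt0.
Unshelve. all: by end_near. Qed.

(** Shaped for the mean value theorem, which yields for each [t] some intermediate point without any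
    control beyond its distance to [x]. *)
Lemma cvg_near_point n (F : R -> R) (g : 'rV[R]_n -> R) (x : 'rV[R]_n) (C : R) :
  {for x, continuous g} ->
  (\forall t \near 0^', exists2 z : 'rV[R]_n, `|z - x| <= C * `|t| & F t = g z) ->
  F @ 0^' --> g x.
Proof.
move=> gx Fg; apply/cvgrPdist_lt => e e0.
have /cvgrPdist_lt/(_ _ e0)/(near0_ball C) := gx.
by apply: filter_app; apply: filterS Fg => t [z zx ->]; apply.
Qed.

Lemma norm_two_steps n (u w x : 'rV[R]_n) (s s' t : R) : `|s| <= 1 -> `|s'| <= 1 ->
  `|s *: (t *: w) + (s' *: (t *: u) + x) - x| <= (`|u| + `|w|) * `|t|.
Proof.
move=> s1 s'1; rewrite addrA addrK (le_trans (ler_normD _ _))// !normrZ.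
by rewrite addrC mulrDl ![_ * `|t|]mulrC lerD// ler_piMl// mulr_ge0.
Qed.

(** The increment from [x] to [x + t (u + w)] is split at [x + t u]. The first leg gives ['D_u f x];
    the second is [t] times ['D_w f] at an intermediate point, which tends to ['D_w f x] by
    continuity of the derivative. *)
Lemma is_derive_add_dir n (U : set 'rV[R]_n) (f : 'rV[R]_n -> R) (x u w : 'rV[R]_n) :
  open U -> U x -> Ck 1 U f -> is_derive x (u + w) f ('D_u f x + 'D_w f x).
Proof.
move=> oU Ux fU.
have H1 : (fun t : R => t^-1 * (f (t *: w + (t *: u + x)) - f (t *: u + x))) @ 0^' --> 'D_w f x.
  apply: (@cvg_near_point _ _ (fun z => 'D_w f z) _ (`|u| + `|w|)).
    by apply: Ck_continuous Ux; exact: Ck_derive fU.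
  near=> t.
  have Ut : forall z : 'rV[R]_n, `|z - x| <= (`|u| + `|w|) * `|t| -> U z.
    by near: t; apply: near0_ball; exact: open_nbhs_nbhs.
  have t0 : t != 0 by near: t; exact: nbhs_dnbhs_neq.
  have bd s : 0 <= s <= 1 -> `|s *: (t *: w) + (t *: u + x) - x| <= (`|u| + `|w|) * `|t|.
    move=> /andP[s0 s1]; rewrite -[t *: u]scale1r norm_two_steps ?normr1//.
    by rewrite ger0_norm.
  have dU z : U z -> derivable f z w by exact: Ck_derivable fU.
  have [s s01 ->] := @derive_mvt _ f (t *: u + x) (t *: w)
     (fun s s01 => @ex_derive _ _ _ _ _ _ _ (is_derive_scale_dir t (dU _ (Ut _ (bd s s01))))).
  exists (s *: (t *: w) + (t *: u + x)); first exact: bd.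
  by rewrite derive_scale_dir ?mulKf//; exact: dU _ (Ut _ (bd s s01)).
have H2 : (fun t : R => t^-1 *: ((f \o shift x) (t *: u) - f x)) @ 0^' --> 'D_u f x.
  exact: (Ck_derivable fU Ux).
have E : (fun t : R => t^-1 *: ((f \o shift x) (t *: (u + w)) - f x)) @ 0^' --> 'D_u f x + 'D_w f x.
  have -> : (fun t : R => t^-1 *: ((f \o shift x) (t *: (u + w)) - f x)) =
     (fun t : R => t^-1 *: ((f \o shift x) (t *: u) - f x) +
       t^-1 * (f (t *: w + (t *: u + x)) - f (t *: u + x))).
    apply/funext => t /=; rewrite -[t^-1 * _]/(t^-1 *: _) -scalerDr; congr (_ *: _).
    have -> : t *: (u + w) + x = t *: w + (t *: u + x).
      by rewrite scalerDr -!addrA; exact: addrCA.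
    by rewrite [RHS]addrC; rewrite subrKA.
  exact: (cvgD H2 H1).
by split; [apply/cvg_ex; eexists; exact: E|exact/cvg_lim].
Unshelve. all: by end_near. Qed.

Lemma derive_sum_coord n (U : set 'rV[R]_n) (f : 'rV[R]_n -> R) (x v : 'rV[R]_n) :
  open U -> U x -> Ck 1 U f ->
  'D_v f x = \sum_j v 0 j * 'D_(delta_mx 0 j) f x.
Proof.
move=> oU Ux fU; rewrite {1}(row_sum_delta v).
elim: (index_enum _) => [|j r IH]; first by rewrite !big_nil derive0.
rewrite !big_cons; have [_ ->] := @is_derive_add_dir _ _ _ x (v 0 j *: delta_mx 0 j)
  (\sum_(j <- r) v 0 j *: delta_mx 0 j) oU Ux fU.
by rewrite IH; have [_ ->] := is_derive_scale_dir (v 0 j) (Ck_derivable (v := delta_mx 0 j) fU Ux).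
Qed.

Lemma is_derive_translate n (V : normedModType R) (f : 'rV[R]_n -> V) (c y v : 'rV[R]_n) :
  derivable f (c + y) v -> is_derive y v (fun z => f (c + z)) ('D_v f (c + y)).
Proof.
have E : (fun h : R => h^-1 *: (((fun z => f (c + z)) \o shift y) (h *: v) - f (c + y))) =
         (fun h : R => h^-1 *: ((f \o shift (c + y)) (h *: v) - f (c + y))).
  by apply/funext => h /=; rewrite addrCA.
by rewrite /derivable -E => d; split; rewrite /derive ?E.
Qed.

(** The mean value theorem for [phi y = f (t w + y) - f y] in direction [t u], then for ['D_u f] in
    direction [t w], turns the second difference into [t ^+ 2] times the mixed derivative at a point
    near [x]. *)
Lemma second_difference n (U : set 'rV[R]_n) (f : 'rV[R]_n -> R) (x u w : 'rV[R]_n) :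
  open U -> U x -> Ck 2 U f ->
  (fun t : R => t^-1 * (t^-1 * ((f (t *: w + (t *: u + x)) - f (t *: u + x)) -
     (f (t *: w + x) - f x)))) @ 0^' --> 'D_w (fun z => 'D_u f z) x.
Proof.
move=> oU Ux fU.
apply: (@cvg_near_point _ _ (fun z => 'D_w (fun z => 'D_u f z) z) _ (`|u| + `|w|)).
  by apply: Ck_continuous Ux; exact: Ck_derive (Ck_derive _ fU).
near=> t.
have Ut : forall z : 'rV[R]_n, `|z - x| <= (`|u| + `|w|) * `|t| -> U z.
  by near: t; apply: near0_ball; exact: open_nbhs_nbhs.
have t0 : t != 0 by near: t; exact: nbhs_dnbhs_neq.
have bd s' s : 0 <= s' <= 1 -> 0 <= s <= 1 ->
    `|s' *: (t *: w) + (s *: (t *: u) + x) - x| <= (`|u| + `|w|) * `|t|.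
  by move=> /andP[? ?] /andP[? ?]; rewrite norm_two_steps ?ger0_norm.
have d1 z v : U z -> derivable f z v by exact: Ck_derivable fU.
have d2 z v : U z -> derivable (fun z => 'D_u f z) z v.
  by move=> Uz; apply: Ck_derivable Uz; exact: Ck_derive fU.
pose phi y := f (t *: w + y) - f y.
have Us s : 0 <= s <= 1 -> U (s *: (t *: u) + x).
  move=> s01; apply: Ut; have := bd 0 s; rewrite scale0r add0r; apply => //.
  by rewrite lexx ler01.
have Us' s : 0 <= s <= 1 -> U (t *: w + (s *: (t *: u) + x)).
  move=> s01; apply: Ut; have := bd 1 s; rewrite scale1r; apply => //.
  by rewrite lexx ler01.
have dphi s : 0 <= s <= 1 -> is_derive (s *: (t *: u) + x) (t *: u) phi
     (t * ('D_u f (t *: w + (s *: (t *: u) + x)) - 'D_u f (s *: (t *: u) + x))).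
  move=> s01; rewrite mulrBr; apply: (@is_deriveB _ _ _ (fun y => f (t *: w + y)) f).
    have [_ E] := is_derive_scale_dir t (d1 _ u (Us' _ s01)).
    rewrite -[t * _]E; apply: is_derive_translate; exact: d1 (Us' _ s01).
  exact: is_derive_scale_dir (d1 _ u (Us _ s01)).
have [s s01 E1] := @derive_mvt _ phi x (t *: u)
  (fun s s01 => @ex_derive _ _ _ _ _ _ _ (dphi s s01)).
have [s' s'01 E2] := @derive_mvt _ (fun z => 'D_u f z) (s *: (t *: u) + x) (t *: w)
   (fun s' s'01 => d2 _ _ (Ut _ (bd _ _ s'01 s01))).
exists (s' *: (t *: w) + (s *: (t *: u) + x)); first exact: bd.
have -> : f (t *: w + (t *: u + x)) - f (t *: u + x) - (f (t *: w + x) - f x) =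
  phi (t *: u + x) - phi x by [].
have [_ D1] := dphi s s01.
rewrite E1 D1 E2.
rewrite derive_scale_dir; last exact: d2 _ w (Ut _ (bd _ _ s'01 s01)).
by move: ('D_w _ _) => D2; rewrite !mulKf.
Unshelve. all: by end_near. Qed.

(** Schwarz's theorem: the second difference is symmetric in [u] and [w], so both mixed derivatives
    are its limit. *)
Lemma derive_swap n (U : set 'rV[R]_n) (f : 'rV[R]_n -> R) (x u w : 'rV[R]_n) :
  open U -> U x -> Ck 2 U f ->
  'D_u (fun z => 'D_w f z) x = 'D_w (fun z => 'D_u f z) x.
Proof.
move=> oU Ux fU; apply: cvg_unique (second_difference (w := u) (u := w) oU Ux fU) _ => //.
have /= := @second_difference _ _ _ x u w oU Ux fU.
rewrite (_ : (fun t : R => _) = (fun t : R => t^-1 * (t^-1 *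
   ((f (t *: u + (t *: w + x)) - f (t *: w + x)) - (f (t *: u + x) - f x)))))//.
apply/funext => t; congr (_ * (_ * _)).
rewrite (addrCA (t *: u)).
by rewrite !opprB addrACA [RHS]addrACA; congr (_ + _); rewrite addrC.
Qed.


Lemma cvg_sum (I T : Type) (F : set_system T) (FF : Filter F) (r : seq I)
    (f : I -> T -> R) (a : I -> R) :
  (forall i, f i @ F --> a i) ->
  (fun t => \sum_(i <- r) f i t) @ F --> \sum_(i <- r) a i.
Proof. by move=> fa; apply: cvg_big => //; exact: add_continuous. Qed.

Lemma Ck_le n (V : normedModType R) j k (U : set 'rV[R]_n) (f : 'rV[R]_n -> V) :
  (j <= k)%N -> Ck k U f -> Ck j U f.
Proof.
move=> /subnK <-; elim: (k - j)%N => [//|i IH] fU.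
by apply: IH; exact: CkW.
Qed.

(* Only directional derivatives are available, so the increment of [f] from [g x] to
   [g (h *: v + x)] is computed by the mean value theorem on the segment between them. *)
Lemma is_derive_comp n m (W : set 'rV[R]_m) (f : 'rV[R]_m -> R)
    (g : 'rV[R]_n -> 'rV[R]_m) (x v : 'rV[R]_n) :
  open W -> W (g x) -> Ck 1 W f -> derivable g x v ->
  is_derive x v (f \o g) ('D_('D_v g x) f (g x)).
Proof.
move=> oW Wgx fW dg.
pose d (h : R) := g (h *: v + x) - g x.
have dg0 : (fun h : R => h^-1 *: d h) @ 0^' --> 'D_v g x by exact: dg.
have d0 : `|d h| @[h --> (0 : R)^'] --> (0 : R).
  have : `|d h| @[h --> (0 : R)] --> (0 : R).
    rewrite -[X in _ --> X](@normr0 _ 'rV[R]_m) -(subrr (g x)).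
    apply: cvg_norm; apply: cvgB; last exact: cvg_cst.
    exact: continuous_line.
  exact: cvg_within_filter.
have /nbhs_ballP[r /= r0 rW] := open_nbhs_nbhs (conj oW Wgx).
pose P h z := [/\ `|z - g x| <= `|d h|, W z & f (g (h *: v + x)) - f (g x) = 'D_(d h) f z].
(* The same intermediate point must serve all partial derivatives at once, so it is chosen as a
   function of [h]. By [Pz] the default [g x] plays no part for [h] close to [0]. *)
pose z h := xget (g x) [set z | P h z].
have Pz : \forall h \near (0 : R)^', P h (z h).
  near=> h.
  have bd s : 0 <= s <= 1 -> `|s *: d h + g x - g x| <= `|d h|.
    by move=> /andP[s0 s1]; rewrite addrK normrZ ger0_norm// ler_piMl.
  have Wb s : 0 <= s <= 1 -> W (s *: d h + g x).
    move=> s01; apply: rW; rewrite -ball_normE/= distrC (le_lt_trans (bd _ s01))//.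
    near: h; have /cvgrPdist_lt/(_ _ r0) := d0.
    by apply: filterS => h; rewrite sub0r normrN normr_id.
  have [s s01 E] := @derive_mvt _ f (g x) (d h)
     (fun s s01 => Ck_derivable (v := d h) fW (Wb s s01)).
  suff : exists z, P h z by move=> [y Py]; rewrite /z; case: xgetP => [y' -> //|/(_ y)].
  exists (s *: d h + g x); split; [exact: bd|exact: Wb|].
  by rewrite -E /d subrK.
have zg : z @ 0^' --> g x.
  apply/cvgrPdist_lt => e e0.
  have /cvgrPdist_lt/(_ _ e0) := d0.
  apply: filter_app; apply: filterS Pz => h [zh _ _].
  by rewrite sub0r normrN normr_id => he; rewrite distrC (le_lt_trans zh).
(* Both the direction and the base point vary with [h]. In coordinates they separate: the direction
   converges by [dg0], and the partial derivatives of [f] are continuous along [z h]. *)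
have lim : (fun h : R => \sum_j (h^-1 *: d h) 0 j * 'D_(delta_mx 0 j) f (z h)) @ 0^' -->
    'D_('D_v g x) f (g x).
  rewrite (derive_sum_coord ('D_v g x) oW Wgx fW); apply: cvg_sum => j.
  apply: cvgM.
    apply: (@continuous_cvg _ _ _ _ _ _ (fun M : 'rV[R]_m => M 0 j) _ _ dg0).
    exact: coord_continuous.
  apply: (@continuous_cvg _ _ _ _ _ z (fun y => 'D_(delta_mx 0 j) f y) _ _ zg).
  exact: Ck_continuous (Ck_derive (delta_mx 0 j) fW) Wgx.
have lim' : (fun h : R => h^-1 *: (((f \o g) \o shift x) (h *: v) - (f \o g) x)) @ 0^' -->
    'D_('D_v g x) f (g x).
  apply: cvg_trans lim; apply: near_eq_cvg.
  apply: filterS Pz => h [_ Wz E] /=.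
  rewrite E (derive_sum_coord (d h) oW Wz fW) scaler_sumr.
  by apply: eq_bigr => j _; rewrite mxE -mulrA.
by split; [apply/cvg_ex; eexists; exact: lim'|exact/cvg_lim].
Unshelve. all: by end_near. Qed.

Lemma Ck_coord n m k (U : set 'rV[R]_n) (f : 'rV[R]_n -> 'rV[R]_m) j : open U ->
  Ck k U f -> Ck k U (fun x => f x 0 j).
Proof.
move=> oU; elim: k f => [|k IH] f fU.
  split=> // x Ux.
  exact: (@continuous_comp _ _ _ f (fun M : 'rV[R]_m => M 0 j) x
    (Ck_continuous fU Ux) (@coord_continuous _ _ _ _ _ _)).
split=> [x Ux|v].
  exact: (@continuous_comp _ _ _ f (fun M : 'rV[R]_m => M 0 j) x
    (Ck_continuous fU Ux) (@coord_continuous _ _ _ _ _ _)).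
split=> [x Ux|].
  by have /derivable_mxP := Ck_derivable (v := v) fU Ux.
apply: (@Ck_ext _ _ _ _ _ (fun x => 'D_v f x 0 j)) => //.
  by move=> x Ux; rewrite derive_mx ?mxE//; exact: Ck_derivable fU Ux.
by apply: IH; exact: Ck_derive.
Qed.

Lemma continuous_row n (T : topologicalType) (f : T -> 'rV[R]_n) (x : T) :
  (forall j, {for x, continuous (fun y => f y 0 j)}) -> {for x, continuous f}.
Proof.
move=> fj; apply/cvgrPdist_le => e e0.
near=> y.
rewrite /Num.Def.normr/= mx_normrE (bigmax_le _ (ltW e0))//= => i _.
rewrite !mxE ord1 /=.
move: i; near: y; apply: filter_forall => /= i.
exact: ((cvgrPdist_le _ _).1 (fj i.2)).
Unshelve. all: by end_near. Qed.

(** The mean value theorem in equality form holds only for real functions; vector-valued maps are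
    reduced to them coordinate by coordinate. *)
Lemma Ck_row n m k (U : set 'rV[R]_n) (f : 'rV[R]_n -> 'rV[R]_m) : open U ->
  (forall j, Ck k U (fun x => f x 0 j)) -> Ck k U f.
Proof.
move=> oU; elim: k f => [|k IH] f fU.
  by split=> // x Ux; apply: continuous_row => j; exact: Ck_continuous (fU j) Ux.
have df x v : U x -> derivable f x v.
  by move=> Ux; apply/derivable_mxP => i j; rewrite ord1; exact: Ck_derivable (fU j) Ux.
split=> [x Ux|v].
  by apply: continuous_row => j; exact: Ck_continuous (fU j) Ux.
split=> [x Ux|]; first exact: df.
apply: IH => j.
apply: (@Ck_ext _ _ _ _ _ (fun x => 'D_v (fun x => f x 0 j) x)) => //.
  by move=> x Ux; rewrite derive_mx ?mxE//; exact: df.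
exact: Ck_derive (fU j).
Qed.

(** By the chain rule a derivative of [f \o g] is a sum of products of a coordinate of ['D_v g] with
    a partial derivative of [f] composed with [g], to which the induction hypothesis applies. *)
Lemma Ck_comp n m k (U : set 'rV[R]_n) (W : set 'rV[R]_m) (f : 'rV[R]_m -> R)
    (g : 'rV[R]_n -> 'rV[R]_m) :
  open U -> open W -> (forall x, U x -> W (g x)) ->
  Ck k W f -> Ck k U g -> Ck k U (f \o g).
Proof.
move=> oU oW UW; elim: k f => [|k IH] f fW gU.
  split=> // x Ux; apply: continuous_comp; first exact: Ck_continuous gU Ux.
  by apply: Ck_continuous fW _; exact: UW.
have f1 : Ck 1 W f by exact: Ck_le fW.
split=> [x Ux|v].
  apply: continuous_comp; first exact: Ck_continuous gU Ux.
  by apply: Ck_continuous fW _; exact: UW.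
have D x : U x -> is_derive x v (f \o g) ('D_('D_v g x) f (g x)).
  by move=> Ux; apply: is_derive_comp f1 _ => //; [exact: UW|exact: Ck_derivable gU Ux].
split=> [x Ux|]; first by case: (D x Ux).
apply: (@Ck_ext _ _ _ _ _ (fun x => \sum_j 'D_v g x 0 j * 'D_(delta_mx 0 j) f (g x))) => //.
  move=> x Ux; have [_ ->] := D x Ux.
  exact: derive_sum_coord oW (UW _ Ux) f1.
apply: Ck_sum => // j; apply: CkM => //.
  by apply: Ck_coord => //; exact: Ck_derive.
apply: (IH (fun y => 'D_(delta_mx 0 j) f y)); last exact: CkW.
exact: Ck_derive.
Qed.

Lemma Ck_comp_row n m l k (U : set 'rV[R]_n) (W : set 'rV[R]_m) (f : 'rV[R]_m -> 'rV[R]_l)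
    (g : 'rV[R]_n -> 'rV[R]_m) :
  open U -> open W -> (forall x, U x -> W (g x)) ->
  Ck k W f -> Ck k U g -> Ck k U (f \o g).
Proof.
move=> oU oW UW fW gU; apply: Ck_row => // j.
exact: (@Ck_comp _ _ _ _ _ (fun y => f y 0 j) g oU oW UW (Ck_coord j oW fW) gU).
Qed.

Lemma is_derive_comp_row n m l (W : set 'rV[R]_m) (f : 'rV[R]_m -> 'rV[R]_l)
    (g : 'rV[R]_n -> 'rV[R]_m) (x v : 'rV[R]_n) :
  open W -> W (g x) -> Ck 1 W f -> derivable g x v ->
  is_derive x v (f \o g) ('D_('D_v g x) f (g x)).
Proof.
move=> oW Wgx fW dg.
have D j : is_derive x v (fun y => f (g y) 0 j) ('D_('D_v g x) (fun y => f y 0 j) (g x)).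
  exact: (is_derive_comp oW Wgx (Ck_coord j oW fW) dg).
have dfg : derivable (f \o g) x v.
  by apply/derivable_mxP => i j; rewrite ord1; case: (D j).
split; first exact: dfg.
apply/rowP => j; rewrite (derive_mx dfg) mxE.
have [_ ->] := D j.
have df : derivable f (g x) ('D_v g x) by exact: Ck_derivable fW Wgx.
by rewrite [in RHS]derive_mx// mxE.
Qed.

Lemma derive_lin_dir n (U : set 'rV[R]_n) m (f : 'rV[R]_n -> 'rV[R]_m) (x u v : 'rV[R]_n) (a : R) :
  open U -> U x -> Ck 1 U f ->
  'D_(a *: u + v) f x = a *: 'D_u f x + 'D_v f x.
Proof.
move=> oU Ux fU; have df w : derivable f x w by exact: Ck_derivable fU Ux.
apply/rowP => j; rewrite !derive_mx// !mxE.
have fj := Ck_coord j oU fU.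
have [_ ->] := is_derive_add_dir (a *: u) v oU Ux fj.
by rewrite derive_scale_dir//; exact: Ck_derivable fj Ux.
Qed.

Lemma is_derive_comp1 n (h : R -> R) (f : 'rV[R]_n -> R) (x v : 'rV[R]_n) (dh : R) :
  is_derive (f x) 1 h dh -> derivable f x v ->
  is_derive x v (h \o f) (dh * 'D_v f x).
Proof.
move=> Dh df; pose phi (t : R) := f (t *: v + x).
have phi0 : phi 0 = f x by rewrite /phi scale0r add0r.
have Dphi : is_derive (0 : R) 1 phi ('D_v f x).
  by have := @is_derive_line _ _ f x v 0; rewrite scale0r add0r => /(_ df).
have [d1 d2] : is_derive (0 : R) 1 (h \o phi) (dh * 'D_v f x).
  by apply: is_derive1_comp; rewrite phi0.
have E : (fun t : R => t^-1 *: (((h \o phi) \o shift 0) (t *: 1) - (h \o phi) 0)) =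
    (fun t => t^-1 *: (((h \o f) \o shift x) (t *: v) - (h \o f) x)).
  by apply/funext => t /=; rewrite phi0 /phi addr0 [t *: 1]mulr1.
by move: d1 d2; rewrite /derivable /derive E.
Qed.

Lemma Ck_ln n k (U : set 'rV[R]_n) (f : 'rV[R]_n -> R) : open U -> (forall x, U x -> 0 < f x) ->
  Ck k U f -> Ck k U (fun x => ln (f x)).
Proof.
move=> oU f0 fU.
have c x : U x -> {for x, continuous (fun x => ln (f x))}.
  move=> Ux; apply: continuous_comp; first exact: Ck_continuous fU Ux.
  exact/continuous_ln/f0.
case: k fU => [|k] fU; first by split.
have D x v : U x -> is_derive x v (@ln R \o f) ((f x)^-1 * 'D_v f x).
  move=> Ux; apply: is_derive_comp1; first exact/is_derive1_ln/f0.
  exact: Ck_derivable fU Ux.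
split=> // v; split=> [x Ux|]; first by case: (D x v Ux).
apply: (@Ck_ext _ _ _ _ _ (fun x => (f x)^-1 * 'D_v f x)) => //.
  by move=> x Ux; have [_ ->] := D x v Ux.
apply: CkM => //; last exact: Ck_derive.
apply: CkV => //; last exact: CkW.
by move=> x Ux; rewrite gt_eqF// f0.
Qed.

(** Near a point [x] where [f] is not zero its sign is constant, so the absolute value is locally
    the constant multiple [Num.sg (f x) * f]. *)
Lemma Ck_norm n k (U : set 'rV[R]_n) (f : 'rV[R]_n -> R) : open U ->
  (forall x, U x -> f x != 0) -> Ck k U f -> Ck k U (fun x => `|f x|).
Proof.
move=> oU f0 fU; apply: Ck_near => x Ux.
have cf := Ck_continuous fU Ux.
have N : \forall y \near x, f y * f x > 0.
  have cc : {for x, continuous (fun y => f y * f x)}.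
    exact: (cvgM cf (cvg_cst _)).
  apply: (cc [set r : R | 0 < r]); apply: open_nbhs_nbhs; split; first exact: open_gt.
  by rewrite /= -expr2 exprn_even_gt0//= f0.
exists (fun y => Num.sg (f x) * f y), (interior (U `&` [set y | f y * f x > 0])); split.
- exact: open_interior.
- by apply: filterI => //; exact: open_nbhs_nbhs.
- apply: CkM; [exact: open_interior|exact: Ck_cst|].
  by apply: CkS fU => y /interior_subset[].
- move=> y /interior_subset[_ /= h]; rewrite normrEsg; congr (_ * _).
  move: h; have [fx|fx|->] := ltgtP (f x) 0; last by rewrite mulr0 ltxx.
    by rewrite nmulr_lgt0// => fy; rewrite !ltr0_sg.
  by rewrite pmulr_lgt0// => fy; rewrite !gtr0_sg.
Qed.

End Calculus.

(** * Smooth dependence on parameters *)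

Section Slices.
Context {R : realType} {d n : nat}.
Implicit Types (s v : 'rV[R]_d) (y w : 'rV[R]_n).

Lemma continuous_row_mx (T : topologicalType) (f : T -> 'rV[R]_d) (g : T -> 'rV[R]_n) (x : T) :
  {for x, continuous f} -> {for x, continuous g} ->
  {for x, continuous (fun z => row_mx (f z) (g z))}.
Proof.
move=> cf cg; apply: continuous_row => j.
case: (split_ordP j) => i ->.
  rewrite (_ : (fun z => _) = (fun z => f z 0 i)).
    exact: (@continuous_comp _ _ _ f (fun M : 'rV[R]_d => M 0 i) x cf
    (@coord_continuous _ _ _ _ _ _)).
  by apply/funext => z; rewrite row_mxEl.
rewrite (_ : (fun z => _) = (fun z => g z 0 i)).
  exact: (@continuous_comp _ _ _ g (fun M : 'rV[R]_n => M 0 i) x cg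
    (@coord_continuous _ _ _ _ _ _)).
by apply/funext => z; rewrite row_mxEr.
Qed.

Lemma continuous_lsubmx : continuous (@lsubmx R 1 d n).
Proof.
move=> z; apply: continuous_row => j.
rewrite (_ : (fun z => _) = (fun z : 'rV[R]_(d + n) => z 0 (lshift n j))).
  exact: coord_continuous.
by apply/funext => x; rewrite mxE.
Qed.

Lemma continuous_rsubmx : continuous (@rsubmx R 1 d n).
Proof.
move=> z; apply: continuous_row => j.
rewrite (_ : (fun z => _) = (fun z : 'rV[R]_(d + n) => z 0 (rshift d j))).
  exact: coord_continuous.
by apply/funext => x; rewrite mxE.
Qed.

(** Equality of the difference quotients themselves lets derivatives of slices and partial
    derivatives be exchanged at every point, including points where their existence is not known. *)
Lemma growth_row_mxr (V : normedModType R) (f : 'rV[R]_(d + n) -> V) s y w :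
  (fun h : R => h^-1 *: ((f \o shift (row_mx s y)) (h *: row_mx 0 w) - f (row_mx s y))) =
  (fun h : R => h^-1 *: (((fun y => f (row_mx s y)) \o shift y) (h *: w) - f (row_mx s y))).
Proof.
by apply/funext => h /=; rewrite scale_row_mx add_row_mx scaler0 add0r.
Qed.

Lemma growth_row_mxl (V : normedModType R) (f : 'rV[R]_(d + n) -> V) s y v :
  (fun h : R => h^-1 *: ((f \o shift (row_mx s y)) (h *: row_mx v 0) - f (row_mx s y))) =
  (fun h : R => h^-1 *: (((fun s => f (row_mx s y)) \o shift s) (h *: v) - f (row_mx s y))).
Proof.
by apply/funext => h /=; rewrite scale_row_mx add_row_mx scaler0 add0r.
Qed.

Lemma derive_row_mxr (V : normedModType R) (f : 'rV[R]_(d + n) -> V) s y w :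
  'D_w (fun y => f (row_mx s y)) y = 'D_(row_mx 0 w) f (row_mx s y).
Proof. by rewrite /derive growth_row_mxr. Qed.

Lemma derivable_row_mxr (V : normedModType R) (f : 'rV[R]_(d + n) -> V) s y w :
  derivable f (row_mx s y) (row_mx 0 w) -> derivable (fun y => f (row_mx s y)) y w.
Proof. by rewrite /derivable growth_row_mxr. Qed.

Lemma derive_row_mxl (V : normedModType R) (f : 'rV[R]_(d + n) -> V) s y v :
  'D_v (fun s => f (row_mx s y)) s = 'D_(row_mx v 0) f (row_mx s y).
Proof. by rewrite /derive growth_row_mxl. Qed.

Lemma Ck_slice (V : normedModType R) k (W : set 'rV[R]_(d + n)) (Y : set 'rV[R]_n) s
    (f : 'rV[R]_(d + n) -> V) :
  (forall y, Y y -> W (row_mx s y)) -> Ck k W f -> Ck k Y (fun y => f (row_mx s y)).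
Proof.
move=> YW; elim: k f => [|k IH] f fW.
  split=> // y Yy.
  apply: (@continuous_comp _ _ _ (fun y => row_mx s y) f).
    by apply: continuous_row_mx; [exact: cst_continuous|exact: cvg_id].
  exact: Ck_continuous fW (YW _ Yy).
split=> [y Yy|w].
  apply: (@continuous_comp _ _ _ (fun y => row_mx s y) f).
    by apply: continuous_row_mx; [exact: cst_continuous|exact: cvg_id].
  exact: Ck_continuous fW (YW _ Yy).
split=> [y Yy|].
  by apply: derivable_row_mxr; exact: Ck_derivable fW (YW _ Yy).
have -> : (fun y => 'D_w (fun y => f (row_mx s y)) y) =
          (fun y => 'D_(row_mx 0 w) f (row_mx s y)).
  by apply/funext => y; rewrite derive_row_mxr.
by apply: (IH (fun z => 'D_(row_mx 0 w) f z)); exact: Ck_derive.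
Qed.

Lemma iter_deriv_slice (l : seq 'rV[R]_n) (f : 'rV[R]_(d + n) -> R) s :
  iter_deriv l (fun y => f (row_mx s y)) =
  fun y => iter_deriv [seq row_mx 0 w | w <- l] f (row_mx s y).
Proof.
elim: l => [//|w l IH] /=.
by rewrite -/(iter_deriv l _) IH; apply/funext => y; rewrite derive_row_mxr.
Qed.

End Slices.

Section IteratedDerivatives.
Context {R : realType} {n : nat}.
Implicit Types (f g : 'rV[R]_n -> R) (l : seq 'rV[R]_n) (U : set 'rV[R]_n).

Lemma smooth_on_iter_deriv U l f : smooth_on U f -> smooth_on U (iter_deriv l f).
Proof.
move=> fU; elim: l => [//|v l IH] k.
exact: Ck_derive (IH k.+1).
Qed.

Lemma iter_derivZB U l (a : R) f g y : open U -> smooth_on U f -> smooth_on U g -> U y ->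
  iter_deriv l (fun x => a * (f x - g x)) y = a * (iter_deriv l f y - iter_deriv l g y).
Proof.
move=> oU fU gU; elim: l y => [//|v l IH] y Uy /=.
rewrite (@near_eq_derive _ _ _ _ (fun x => a * (iter_deriv l f x - iter_deriv l g x))); last first.
  by apply: filterS (open_nbhs_nbhs (conj oU Uy)) => x; exact: IH.
have df : derivable (iter_deriv l f) y v.
  exact: Ck_derivable (smooth_on_iter_deriv l fU 1) Uy.
have dg : derivable (iter_deriv l g) y v.
  exact: Ck_derivable (smooth_on_iter_deriv l gU 1) Uy.
have [_ ->] := @is_deriveZ _ _ _ (iter_deriv l f - iter_deriv l g) a y v _
  (is_deriveB (derivableP df) (derivableP dg)).
by [].
Qed.

Lemma iter_deriv_swap U l f v y : open U -> smooth_on U f -> U y ->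
  iter_deriv l (fun x => 'D_v f x) y = 'D_v (iter_deriv l f) y.
Proof.
move=> oU fU; elim: l y => [//|w l IH] y Uy /=.
rewrite (@near_eq_derive _ _ _ _ (fun x => 'D_v (iter_deriv l f) x)); last first.
  by apply: filterS (open_nbhs_nbhs (conj oU Uy)) => x; exact: IH.
exact: derive_swap oU Uy (smooth_on_iter_deriv l fU 2).
Qed.

End IteratedDerivatives.

(** * Jointly smooth functions and the C^oo-topology *)

Section JointSmoothness.
Context {R : realType} {T : Type} {d n : nat} (A : atlas R T n).

(** Tube lemma: continuity at the points of [{s} * K] becomes uniform over [K] through the covering
    form of compactness. *)
Lemma near_uniform_slice (f : 'rV[R]_(d + n) -> R) (s : 'rV[R]_d) (K : set 'rV[R]_n) (e : R) :
  compact K -> (forall y, K y -> {for row_mx s y, continuous f}) -> 0 < e ->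
  \forall s' \near s, forall y, K y -> `|f (row_mx s y) - f (row_mx s' y)| < e.
Proof.
move=> /compact_near_coveringP cK cf e0.
apply: (cK _ (nbhs s) (fun s' y => `|f (row_mx s y) - f (row_mx s' y)| < e)) => y Ky.
have e20 : 0 < e / 2 by rewrite divr_gt0.
have c1 : {for (y, s), continuous (fun p : 'rV[R]_n * 'rV[R]_d => f (row_mx p.2 p.1))}.
  apply: (@continuous_comp _ _ _ (fun p : 'rV[R]_n * 'rV[R]_d => row_mx p.2 p.1) f); last exact: cf.
  by apply: continuous_row_mx; [exact: cvg_snd|exact: cvg_fst].
(* The covering argument moves the point of [K] together with the parameter, so both values are
   compared with the fixed value at [(s, y)], each within [e / 2]. *)
have c2 : {for (y, s), continuous (fun p : 'rV[R]_n * 'rV[R]_d => f (row_mx s p.1))}.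
  apply: (@continuous_comp _ _ _ (fun p : 'rV[R]_n * 'rV[R]_d => row_mx s p.1) f); last exact: cf.
  by apply: continuous_row_mx; [exact: cst_continuous|exact: cvg_fst].
have /cvgrPdist_lt/(_ _ e20) H1 := c1.
have /cvgrPdist_lt/(_ _ e20) H2 := c2.
near=> p => /=.
rewrite -(subrK (f (row_mx s y)) (f (row_mx s p.1))) -addrA (splitr e).
rewrite (le_lt_trans (ler_normD _ _))// ltrD//; near: p => //.
by apply: filterS H2 => p /=; rewrite distrC.
Unshelve. all: by end_near. Qed.

Lemma Cinfty_cvg_intro (F : set_system (T -> R)) {FF : Filter F} (f : T -> R) :
  (forall c l K e, charts A c -> compact K -> K `<=` cimg c setT -> 0 < e ->
    \forall g \near F, forall y, K y ->
      `|iter_deriv l (f \o cinv c) y - iter_deriv l (g \o cinv c) y| < e) ->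
  Cinfty_cvg A F f.
Proof.
move=> H c l Ac; apply/fam_cvgP => K [cK Kc].
move=> P /uniform_nbhs[E [entE EP]].
move: entE; rewrite -entourage_ballE => -[e /= e0 eE].
have := H c l K e Ac cK Kc e0.
rewrite /= !nbhs_simpl; apply: filterS => g Hg; apply: EP => y Ky.
exact: (eE (_, _) (Hg y Ky)).
Qed.

(* The derivative in the parameter commutes with the derivatives in the charts, and the mean
   value theorem turns pointwise into uniform convergence of the difference quotients on
   compact sets. *)
Lemma Cinfty_Ck_joint k (U : set 'rV[R]_d) (h : 'rV[R]_d -> T -> R) :
  open U -> (forall c, charts A c -> open (cimg c setT)) ->
  (forall c, charts A c ->
    smooth_on [set z : 'rV[R]_(d + n) | U (lsubmx z) /\ cimg c setT (rsubmx z)]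
      (fun z => h (lsubmx z) (cinv c (rsubmx z)))) ->
  Cinfty_Ck A k U h.
Proof.
move=> oU oA; move: h.
pose W (c : chart R T n) := [set z : 'rV[R]_(d + n) | U (lsubmx z) /\ cimg c setT (rsubmx z)].
have oW c : charts A c -> open (W c).
  move=> Ac; apply: openI; first by have /continuousP/(_ _ oU) := @continuous_lsubmx R d n.
  by have /continuousP/(_ _ (oA c Ac)) := @continuous_rsubmx R d n.
have WE s c y : U s -> cimg c setT y -> W c (row_mx s y).
  by move=> Us cy; rewrite /W /= row_mxKl row_mxKr.
pose joint (h : 'rV[R]_d -> T -> R) (c : chart R T n) (z : 'rV[R]_(d + n)) :=
  h (lsubmx z) (cinv c (rsubmx z)).
have fE (h : 'rV[R]_d -> T -> R) s c : h s \o cinv c = (fun y => joint h c (row_mx s y)).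
  by apply/funext => y; rewrite /joint row_mxKl row_mxKr.
have base (h : 'rV[R]_d -> T -> R) s : (forall c, charts A c ->
    smooth_on (W c) (fun z => h (lsubmx z) (cinv c (rsubmx z)))) ->
    U s -> smooth_fun A (h s) /\ Cinfty_cvg A (h @ s) (h s).
  move=> hU Us; split.
    by move=> c Ac j; rewrite fE; apply: Ck_slice (hU c Ac j) => y; exact: WE.
  have F1 : Filter (h @ s) by exact: (@fmap_filter _ _ h (nbhs s) (nbhs_filter s)).
  apply: Cinfty_cvg_intro => c l K e Ac cK Kc e0.
  pose g := iter_deriv [seq row_mx 0 w | w <- l] (joint h c).
  have := @near_uniform_slice g s K e cK.
  have cg y : K y -> {for row_mx s y, continuous g}.
    move=> Ky; apply: Ck_continuous (smooth_on_iter_deriv _ (hU c Ac) 0%N) _.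
    exact: WE (Kc _ Ky).
  move=> /(_ cg e0) H; apply: (@filterS _ _ (nbhs_filter s) _ _ _ H) => s' {}H y Ky.
  by rewrite !fE !iter_deriv_slice; exact: H.
elim: k => [|k IH] h hU.
  by split=> // s Us; exact: base.
split=> [s Us|v]; first exact: base.
exists (fun s x => 'D_v (fun s => h s x) s); split; last first.
  (* The parameter derivative is a partial derivative of the joint function in direction
     [row_mx v 0], hence again jointly smooth. *)
  apply: IH => c Ac j.
  have -> : (fun z : 'rV[R]_(d + n) => 'D_v (h^~ (cinv c (rsubmx z))) (lsubmx z)) =
     (fun z => 'D_(row_mx v 0) (joint h c) z).
    apply/funext => z; rewrite -{3}[z]hsubmxK -derive_row_mxl.
    by congr ('D_v _ _); apply/funext => s; rewrite /joint row_mxKl row_mxKr.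
  exact: Ck_derive (hU c Ac j.+1).
move=> s Us; apply: Cinfty_cvg_intro => c l K e Ac cK Kc e0.
pose g := iter_deriv [seq row_mx 0 w | w <- l] (joint h c).
have gW : smooth_on (W c) g by apply: smooth_on_iter_deriv; exact: hU.
have E1 y : K y -> iter_deriv l ((fun x => 'D_v (h^~ x) s) \o cinv c) y =
    'D_(row_mx v 0) g (row_mx s y).
  move=> Ky.
  have -> : (fun x => 'D_v (h^~ x) s) \o cinv c =
     (fun y => 'D_(row_mx v 0) (joint h c) (row_mx s y)).
    apply/funext => z /=; rewrite -derive_row_mxl.
    by congr ('D_v _ _); apply/funext => s'; rewrite /joint row_mxKl row_mxKr.
  rewrite (iter_deriv_slice l (fun z => 'D_(row_mx v 0) (joint h c) z)).
  exact: iter_deriv_swap (oW c Ac) (hU c Ac) (WE _ _ _ Us (Kc _ Ky)).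
have N1 : \forall s' \near s, U s' /\ forall y, K y ->
    `|'D_(row_mx v 0) g (row_mx s y) - 'D_(row_mx v 0) g (row_mx s' y)| < e.
  near=> s'; split; near: s'; first exact: open_nbhs_nbhs.
  apply: (@near_uniform_slice (fun z => 'D_(row_mx v 0) g z) s K e cK) => // y Ky.
  exact: Ck_continuous (Ck_derive _ (gW 1%N)) (WE _ _ _ Us (Kc _ Ky)).
have : \forall t \near (0 : R)^', forall y, K y ->
    `|iter_deriv l ((fun x => 'D_v (h^~ x) s) \o cinv c) y -
      iter_deriv l ((fun x => t^-1 * (h (s + t *: v) x - h s x)) \o cinv c) y| < e; last by [].
near=> t => y Ky.
have t0 : t != 0 by near: t; exact: nbhs_dnbhs_neq.
have Nt : forall s', `|s' - s| <= `|v| * `|t| -> U s' /\ forall y, K y ->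
    `|'D_(row_mx v 0) g (row_mx s y) - 'D_(row_mx v 0) g (row_mx s' y)| < e.
  by near: t; exact: near0_ball.
have bd a : 0 <= a <= 1 -> `|a *: (t *: v) + s - s| <= `|v| * `|t|.
  move=> /andP[a0 a1]; rewrite addrK !normrZ ger0_norm// [`|v| * _]mulrC.
  by rewrite ler_piMl// mulr_ge0.
have E2 a : a *: (t *: row_mx v 0) + row_mx s y = row_mx (a *: (t *: v) + s) y.
  by rewrite !scale_row_mx add_row_mx !scaler0 add0r.
have dg a : 0 <= a <= 1 -> derivable g (a *: (t *: row_mx v 0) + row_mx s y) (t *: row_mx v 0).
  move=> a01; rewrite E2; apply: Ck_derivable (gW 1%N) (WE _ _ _ _ (Kc _ Ky)).
  by have [] := Nt _ (bd _ a01).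
(* The number [a] depends on [y]. This is harmless because [Nt] controls the derivative over all of
   [K], for every parameter within [|v| * |t|] of [s]. *)
have [a a01 E3] := derive_mvt dg.
have [Ua Na] := Nt _ (bd _ a01).
have U1 : U (s + t *: v).
  have := Nt (s + t *: v); rewrite addrAC subrr add0r normrZ mulrC lexx => /(_ isT)[].
  by [].
rewrite E1//.
have -> : iter_deriv l ((fun x => t^-1 * (h (s + t *: v) x - h s x)) \o cinv c) y =
    'D_(row_mx v 0) g (row_mx (a *: (t *: v) + s) y).
  rewrite (_ : _ \o _ = fun y => t^-1 * ((h (s + t *: v) \o cinv c) y - (h s \o cinv c) y))//.
  rewrite (iter_derivZB l t^-1 (oA c Ac) _ _ (Kc _ Ky)); first last.
  - by move=> j; rewrite fE; apply: Ck_slice (hU c Ac j) => z; exact: WE.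
  - by move=> j; rewrite fE; apply: Ck_slice (hU c Ac j) => z; exact: WE.
  rewrite !fE !iter_deriv_slice -/g.
  have := E2 1; rewrite !scale1r => E4.
  rewrite [s + _]addrC -E4 E3 E2 derive_scale_dir ?mulKf//.
  by apply: Ck_derivable (gW 1%N) (WE _ _ _ Ua (Kc _ Ky)).
exact: Na.
Unshelve. all: by end_near. Qed.

End JointSmoothness.

(** * Charts, smooth maps and one-forms *)

Section Charts.
Context {R : realType} {T : topologicalType} {n : nat}.
Implicit Types (c : chart R T n) (V : set T).

Lemma chart_cinvK c x : is_chart c -> cdom c x -> cinv c (cmap c x) = x.
Proof. by move=> [[_ _ _ h] _]; exact: h. Qed.

Lemma chart_open c : is_chart c -> open (cdom c).
Proof. by move=> [[]]. Qed.

Lemma open_cimgT c : is_chart c -> open (cimg c setT).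
Proof. by move=> [[]]. Qed.

Lemma cimgP c V y : is_chart c ->
  cimg c V y <-> [/\ cdom c (cinv c y), V (cinv c y) & cmap c (cinv c y) = y].
Proof.
move=> hc; split; last by move=> [h1 h2 h3]; exists (cinv c y).
by move=> [x [cx Vx] <-]; rewrite chart_cinvK.
Qed.

Lemma cimgTP c y : is_chart c ->
  cimg c setT y <-> cdom c (cinv c y) /\ cmap c (cinv c y) = y.
Proof. by move=> hc; split=> [/(cimgP _ _ hc)[]|[? ?]]//; apply/cimgP. Qed.

Lemma cimg_cmap c V x : cdom c x -> V x -> cimg c V (cmap c x).
Proof. by move=> cx Vx; exists x. Qed.

Lemma cimg_sub c V W : V `<=` W -> cimg c V `<=` cimg c W.
Proof. by move=> VW y [x [cx /VW Wx] <-]; exists x. Qed.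

(** Within the open image of the chart, [cimg c V] is the preimage of [V] under [cinv c], which is
    continuous there. *)
Lemma open_cimg c V : is_chart c -> open V -> open (cimg c V).
Proof.
move=> hc oV; rewrite openE => y yV; rewrite /interior.
have yT : cimg c setT y by exact: cimg_sub yV.
have [_ Vy _] := (cimgP _ _ hc).1 yV.
have cy := hc.2 _ yT.
have N1 : \forall z \near y, V (cinv c z).
  by apply: cy; exact: open_nbhs_nbhs.
have N2 : \forall z \near y, cimg c setT z.
  by apply: open_nbhs_nbhs; split => //; exact: open_cimgT.
apply: filter_app N1; apply: filterS N2 => z /(cimgTP _ hc)[h1 h2] h3.
exact/cimgP.
Qed.

Lemma near_cmapK c p : is_chart c -> cdom c p ->
  \forall y \near cmap c p, cmap c (cinv c y) = y.
Proof.
move=> hc cp; have N : \forall z \near cmap c p, cimg c setT z.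
  by apply: open_nbhs_nbhs; split; [exact: open_cimgT|exact: cimg_cmap].
by apply: filterS N => z /(cimgTP _ hc)[].
Qed.

End Charts.

Lemma continuous_pair (S T U : topologicalType) (f : S -> T) (g : S -> U) (x : S) :
  {for x, continuous f} -> {for x, continuous g} ->
  {for x, continuous (fun z => (f z, g z))}.
Proof. by move=> cf cg; exact: (cvg_pair cf cg). Qed.

(** * Products of charts *)

Section ProductCharts.
Context {R : realType} {S T : topologicalType} {m n : nat}.
Implicit Types (c : chart R S m) (d : chart R T n).

Lemma cimg_prod_chart c d (U : set S) (V : set T) z : is_chart c -> is_chart d ->
  cimg (prod_chart c d) (U `*` V) z <-> cimg c U (lsubmx z) /\ cimg d V (rsubmx z).
Proof.
move=> hc hd; split.
  by move=> [[x y] [[/= cx dy] [/= Ux Vy]] <-]; rewrite row_mxKl row_mxKr; split;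
    exact: cimg_cmap.
move=> [[x [cx Ux] xz] [y [dy Vy] yz]].
by exists (x, y) => //=; rewrite xz yz hsubmxK.
Qed.

Lemma is_chart_prod c d : is_chart c -> is_chart d -> is_chart (prod_chart c d).
Proof.
move=> hc hd.
have E z : cimg (prod_chart c d) setT z <-> cimg c setT (lsubmx z) /\ cimg d setT (rsubmx z).
  by rewrite -setXTT; exact: cimg_prod_chart.
split; [split|].
- have c1 : continuous (@fst S T) by move=> z; exact: cvg_fst.
  have c2 : continuous (@snd S T) by move=> z; exact: cvg_snd.
  apply: openI.
    by move/continuousP: c1; apply; exact: chart_open hc.
  by move/continuousP: c2; apply; exact: chart_open hd.
- rewrite (_ : cimg _ _ = lsubmx @^-1` cimg c setT `&` rsubmx @^-1` cimg d setT); last first.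
    by apply/seteqP; split=> z /E.
  apply: openI.
    by have /continuousP/(_ _ (open_cimgT hc)) := @continuous_lsubmx R m n.
  by have /continuousP/(_ _ (open_cimgT hd)) := @continuous_rsubmx R m n.
- move=> [x y] [/= cx dy]; apply: continuous_row_mx.
    apply: (@continuous_comp _ _ _ fst (cmap c)); first exact: cvg_fst.
    by have [[_ _ h _] _] := hc; exact: h.
  apply: (@continuous_comp _ _ _ snd (cmap d)); first exact: cvg_snd.
  by have [[_ _ h _] _] := hd; exact: h.
- by move=> [x y] [/= cx dy]; rewrite row_mxKl row_mxKr !chart_cinvK.
move=> z /E[zc zd]; apply: continuous_pair.
  apply: (@continuous_comp _ _ _ lsubmx (cinv c)); first exact: continuous_lsubmx.
  exact: hc.2.
apply: (@continuous_comp _ _ _ rsubmx (cinv d)); first exact: continuous_rsubmx.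
exact: hd.2.
Qed.

Lemma prod_atlas_is_chart (A : atlas R S m) (B : atlas R T n) :
  (forall c, charts A c -> is_chart c) -> (forall d, charts B d -> is_chart d) ->
  forall e, charts (prod_atlas A B) e -> is_chart e.
Proof.
by move=> hA hB e [c [d [Ac Bd ->]]]; apply: is_chart_prod; [exact: hA|exact: hB].
Qed.

End ProductCharts.

Section SmoothMaps.
Context {R : realType}.

Lemma Ck_id n k (U : set 'rV[R]_n) : Ck k U (fun x : 'rV[R]_n => x).
Proof.
case: k => [|k]; first by split=> // x _; exact: cvg_id.
split=> [x _|v]; first exact: cvg_id.
split=> [x _|]; first exact: derivable_id.
have -> : (fun x : 'rV[R]_n => 'D_v (fun x => x) x) = (fun=> v).
  by apply/funext => x; exact: derive_id.
exact: Ck_cst.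
Qed.

Lemma Ck_lsubmx m n k (U : set 'rV[R]_(m + n)) : open U -> Ck k U (@lsubmx R 1 m n).
Proof.
move=> oU; apply: Ck_row => // j.
rewrite (_ : (fun z => _) = (fun z : 'rV[R]_(m + n) => z 0 (lshift n j))).
  exact: (Ck_coord (lshift n j) oU (@Ck_id _ _ _)).
by apply/funext => x; rewrite mxE.
Qed.

Lemma Ck_rsubmx m n k (U : set 'rV[R]_(m + n)) : open U -> Ck k U (@rsubmx R 1 m n).
Proof.
move=> oU; apply: Ck_row => // j.
rewrite (_ : (fun z => _) = (fun z : 'rV[R]_(m + n) => z 0 (rshift m j))).
  exact: (Ck_coord (rshift m j) oU (@Ck_id _ _ _)).
by apply/funext => x; rewrite mxE.
Qed.

Lemma Ck_row_mx l m n k (U : set 'rV[R]_l) (f : 'rV[R]_l -> 'rV[R]_m) (g : 'rV[R]_l -> 'rV[R]_n) :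
  open U -> Ck k U f -> Ck k U g -> Ck k U (fun x => row_mx (f x) (g x)).
Proof.
move=> oU fU gU; apply: Ck_row => // j.
case: (split_ordP j) => i ->.
  rewrite (_ : (fun z => _) = (fun z => f z 0 i)); first exact: Ck_coord.
  by apply/funext => z; rewrite row_mxEl.
rewrite (_ : (fun z => _) = (fun z => g z 0 i)); first exact: Ck_coord.
by apply/funext => z; rewrite row_mxEr.
Qed.

(** Around each point the composite is factored through a chart of the middle space. The hypotheses
    are conditions on single atlases rather than [smooth_manifold], so that the lemma applies
    directly to [prod_atlas]. *)
Lemma smooth_map_comp (S T U : topologicalType) l m n
    (A : atlas R S l) (B : atlas R T m) (C : atlas R U n) (f : S -> T) (g : T -> U) :
  (forall c, charts A c -> is_chart c) -> (forall c, charts B c -> is_chart c) ->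
  (forall c, charts C c -> is_chart c) ->
  (forall x, exists2 c, charts B c & cdom c x) ->
  smooth_map A B f -> smooth_map B C g -> smooth_map A C (g \o f).
Proof.
move=> hA hB hC covB [cf sf] [cg sg]; split.
  by move=> x; apply: continuous_comp; [exact: cf|exact: cg].
move=> c e Ac Ce k; apply: Ck_near => y yc.
have [cy ey yE] := (cimgP _ _ (hA _ Ac)).1 yc.
have [d Bd dfy] := covB (f (cinv c y)).
have o1 : open (g @^-1` cdom e).
  by move/continuousP: cg; apply; exact: chart_open (hC _ Ce).
have o2 : open (f @^-1` (cdom d `&` g @^-1` cdom e)).
  by move/continuousP: cf; apply; apply: openI => //; exact: chart_open (hB _ Bd).
exists ((cmap e \o g \o cinv d) \o (cmap d \o f \o cinv c)),
  (cimg c (f @^-1` (cdom d `&` g @^-1` cdom e))).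
split.
- exact: open_cimg (hA _ Ac) o2.
- by rewrite -yE; exact: cimg_cmap.
- apply: (@Ck_comp_row _ _ _ _ _ _ (cimg d (g @^-1` cdom e))).
  + exact: open_cimg (hA _ Ac) o2.
  + exact: open_cimg (hB _ Bd) o1.
  + move=> z /(cimgP _ _ (hA _ Ac))[_ [h1 h2] _] /=.
    exact: cimg_cmap.
  + exact: sg.
  + apply: CkS (sf c d Ac Bd k); apply: cimg_sub => x [] //.
- move=> z /(cimgP _ _ (hA _ Ac))[_ [h1 h2] _] /=.
  by rewrite chart_cinvK//; exact: hB.
Qed.

Lemma smooth_map_prod (S T S' T' : topologicalType) m n m' n'
    (A : atlas R S m) (B : atlas R T n) (A' : atlas R S' m') (B' : atlas R T' n')
    (f : S -> S') (g : T -> T') :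
  (forall c, charts A c -> is_chart c) -> (forall c, charts B c -> is_chart c) ->
  (forall c, charts A' c -> is_chart c) -> (forall c, charts B' c -> is_chart c) ->
  smooth_map A A' f -> smooth_map B B' g ->
  smooth_map (prod_atlas A B) (prod_atlas A' B') (fun z => (f z.1, g z.2)).
Proof.
move=> hA hB hA' hB' [cf sf] [cg sg]; split.
  move=> z; apply: continuous_pair.
    by apply: (@continuous_comp _ _ _ (@fst S T) f z); [exact: cvg_fst|exact: cf].
  by apply: (@continuous_comp _ _ _ (@snd S T) g z); [exact: cvg_snd|exact: cg].
move=> _ _ [c [d [Ac Bd ->]]] [c' [d' [Ac' Bd' ->]]] k.
have oc : open (cimg c (f @^-1` cdom c')).
  apply: open_cimg; first exact: hA.
  by move/continuousP: cf; apply; exact: chart_open (hA' _ Ac').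
have od : open (cimg d (g @^-1` cdom d')).
  apply: open_cimg; first exact: hB.
  by move/continuousP: cg; apply; exact: chart_open (hB' _ Bd').
rewrite (_ : cimg _ _ = lsubmx @^-1` cimg c (f @^-1` cdom c') `&`
    rsubmx @^-1` cimg d (g @^-1` cdom d')); last first.
  rewrite (_ : _ @^-1` _ = (f @^-1` cdom c') `*` (g @^-1` cdom d'))//.
  by apply/seteqP; split=> z /(cimg_prod_chart _ _ _ (hA _ Ac) (hB _ Bd)).
set W := (X in Ck _ X _).
have oW : open W.
  apply: openI.
    by have /continuousP/(_ _ oc) := @continuous_lsubmx R m n.
  by have /continuousP/(_ _ od) := @continuous_rsubmx R m n.
apply: Ck_row_mx => //.
  apply: (Ck_comp_row oW oc _ (sf c c' Ac Ac' k) (Ck_lsubmx _ oW)).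
  by move=> z [].
apply: (Ck_comp_row oW od _ (sg d d' Bd Bd' k) (Ck_rsubmx _ oW)).
by move=> z [].
Qed.

End SmoothMaps.

(** * Tangent maps and one-forms in charts *)

Section Manifolds.
Context {R : realType} {T : topologicalType} {n : nat} (A : atlas R T n).
Hypothesis mA : smooth_manifold A.
Implicit Types (c d e : chart R T n) (w : T -> 'rV[R]_n -> R).

Lemma mfd_chart c : charts A c -> is_chart c.
Proof. by case: mA => _ _ h _ _; exact: h. Qed.

Lemma mfd_chart_at x : charts A (chart_at A x).
Proof. by case: mA => _ _ _ h _; exact: (h x).1. Qed.

Lemma mfd_cdom_at x : cdom (chart_at A x) x.
Proof. by case: mA => _ _ _ h _; exact: (h x).2. Qed.

Lemma mfd_cover x : exists2 c, charts A c & cdom c x.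
Proof. by exists (chart_at A x); [exact: mfd_chart_at|exact: mfd_cdom_at]. Qed.

Lemma smooth_map_id : smooth_map A A id.
Proof.
split; first by move=> x; exact: cvg_id.
by case: mA => _ _ _ _ h c d; exact: h.
Qed.

(** The chain rule with three arbitrary charts. Taking [f] or [g] to be the identity yields the
    transformation rules under a change of chart. *)
Lemma derive_charts (f g : T -> T) c d e p v :
  smooth_map A A f -> smooth_map A A g -> charts A c -> charts A d -> charts A e ->
  cdom c p -> cdom d (f p) -> cdom e (g (f p)) ->
  'D_v (cmap e \o (g \o f) \o cinv c) (cmap c p) =
  'D_('D_v (cmap d \o f \o cinv c) (cmap c p)) (cmap e \o g \o cinv d) (cmap d (f p)).
Proof.
move=> [cf sf] [cg sg] Ac Ad Ae cp dfp egp.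
have hc := mfd_chart Ac; have hd := mfd_chart Ad; have he := mfd_chart Ae.
have od : open (f @^-1` cdom d) by move/continuousP: cf; apply; exact: chart_open.
have oe : open (g @^-1` cdom e) by move/continuousP: cg; apply; exact: chart_open.
have D : is_derive (cmap c p) v ((cmap e \o g \o cinv d) \o (cmap d \o f \o cinv c))
  ('D_('D_v (cmap d \o f \o cinv c) (cmap c p)) (cmap e \o g \o cinv d)
    ((cmap d \o f \o cinv c) (cmap c p))).
  apply: (@is_derive_comp_row _ _ _ _ (cimg d (g @^-1` cdom e))).
  - exact: open_cimg.
  - by rewrite /= chart_cinvK//; exact: cimg_cmap.
  - exact: sg.
  - by apply: Ck_derivable (sf c d Ac Ad 1%N) _; exact: cimg_cmap.
move: D => [_]; rewrite /= (chart_cinvK hc cp) => <-.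
apply: near_eq_derive.
apply: filterS (open_nbhs_nbhs (conj (open_cimg hc od) _)); last exact: cimg_cmap.
by move=> z /(cimgP _ _ hc)[_ h _] /=; rewrite chart_cinvK.
Qed.

Lemma derive_chart_id c p v : charts A c -> cdom c p ->
  'D_v (cmap c \o cinv c) (cmap c p) = v.
Proof.
move=> Ac cp; rewrite -[RHS](derive_id (cmap c p) v); apply: near_eq_derive.
exact: near_cmapK (mfd_chart Ac) cp.
Qed.

Lemma tangent_map_comp (f g : T -> T) p v :
  smooth_map A A f -> smooth_map A A g ->
  tangent_map A A (g \o f) p v = tangent_map A A g (f p) (tangent_map A A f p v).
Proof.
move=> sf sg; apply: derive_charts => //; by [exact: mfd_chart_at|exact: mfd_cdom_at].
Qed.

Lemma form_in_chartE w c p v : charts A c -> cdom c p ->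
  form_in_chart A w c (cmap c p) v =
  w p ('D_v (cmap (chart_at A p) \o cinv c) (cmap c p)).
Proof. by move=> Ac cp; rewrite /form_in_chart (chart_cinvK (mfd_chart Ac) cp). Qed.

Lemma form_in_chart_at w p v : form_in_chart A w (chart_at A p) (cmap (chart_at A p) p) v = w p v.
Proof.
rewrite (form_in_chartE _ _ (mfd_chart_at p) (mfd_cdom_at p)).
by rewrite (derive_chart_id _ (mfd_chart_at p) (mfd_cdom_at p)).
Qed.

Lemma form_in_chart_lin w c y (a : R) u v : charts A c -> cimg c setT y ->
  (forall p (a : R) (u v : 'rV[R]_n), w p (a *: u + v) = a * w p u + w p v) ->
  form_in_chart A w c y (a *: u + v) = a * form_in_chart A w c y u + form_in_chart A w c y v.
Proof.
move=> Ac yc lw; have hc := mfd_chart Ac; have [cy Ey] := (cimgTP _ hc).1 yc.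
rewrite /form_in_chart -lw; congr (w _ _).
have [_ si] := smooth_map_id.
have hd := mfd_chart (mfd_chart_at (cinv c y)).
apply: (@derive_lin_dir _ _ (cimg c (cdom (chart_at A (cinv c y))))).
- by apply: open_cimg => //; exact: chart_open.
- by apply/cimgP => //; split => //; exact: mfd_cdom_at.
- exact: si Ac (mfd_chart_at _) 1%N.
Qed.

Lemma form_in_chart_sum w c y v : charts A c -> cimg c setT y ->
  (forall p (a : R) (u v : 'rV[R]_n), w p (a *: u + v) = a * w p u + w p v) ->
  form_in_chart A w c y v = \sum_j v 0 j * form_in_chart A w c y (delta_mx 0 j).
Proof.
move=> Ac yc lw; rewrite {1}(row_sum_delta v).
elim: (index_enum _) => [|j r IH]; last first.
  by rewrite !big_cons form_in_chart_lin// IH.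
rewrite !big_nil.
(* Linearity with [a = -1] and zero vectors gives the value [0] on the zero vector. *)
by have := @form_in_chart_lin w c y (-1) 0 0 Ac yc lw;
  rewrite scaler0 addr0 mulN1r addNr.
Qed.

(** Both sides evaluate [w (f p)] on the image of [v]; the chain rule computes this image once
    through the chart chosen at [p] and once through [d]. *)
Lemma form_in_chart_pullback w (f : T -> T) c d p v :
  smooth_map A A f -> charts A c -> charts A d -> cdom c p -> cdom d (f p) ->
  form_in_chart A (pullback A f w) c (cmap c p) v =
  form_in_chart A w d (cmap d (f p)) ('D_v (cmap d \o f \o cinv c) (cmap c p)).
Proof.
move=> sf Ac Ad cp dfp.
rewrite (form_in_chartE _ _ Ac cp) (form_in_chartE _ _ Ad dfp) /pullback /tangent_map.
congr (w _ _).
rewrite -(@derive_charts id f c (chart_at A p) (chart_at A (f p)) p v smooth_map_id sf Ac)//;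
  try by [exact: mfd_chart_at|exact: mfd_cdom_at].
rewrite -(@derive_charts f id c d (chart_at A (f p)) p v sf smooth_map_id Ac)//;
  by [exact: mfd_chart_at|exact: mfd_cdom_at].
Qed.

(** The witness is [u] rewritten in the coordinates of [c]. Thus a form that is nonzero at [p] is
    nonzero there on some constant field of any chart around [p]. *)
Lemma form_in_chart_surj w c p u : charts A c -> cdom c p ->
  exists v, form_in_chart A w c (cmap c p) v = w p u.
Proof.
move=> Ac cp; exists ('D_u (cmap c \o cinv (chart_at A p)) (cmap (chart_at A p) p)).
rewrite form_in_chartE//; congr (w _ _).
rewrite -(@derive_charts id id (chart_at A p) c (chart_at A p) p u smooth_map_id smooth_map_id)//;
  try by [exact: mfd_chart_at|exact: mfd_cdom_at].
exact: derive_chart_id (mfd_chart_at p) (mfd_cdom_at p).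
Qed.

End Manifolds.

(** * Smoothness of the ratio of two proportional forms *)

Section FormFactors.
Context {R : realType} {T : topologicalType} {n : nat} (A : atlas R T n).
Hypothesis mA : smooth_manifold A.
Implicit Types (c d : chart R T n) (w : T -> 'rV[R]_n -> R).

Lemma form_factor_local w p c : smooth_form A w -> charts A c -> cdom c p ->
  (exists u, w p u != 0) ->
  exists v (V : set T), [/\ open V, V p, V `<=` cdom c &
    forall y, cimg c V y -> form_in_chart A w c y v != 0].
Proof.
move=> [_ sw] Ac cp [u wu].
have hc := mfd_chart mA Ac.
have [v Ev] := form_in_chart_surj mA w u Ac cp.
have v0 : form_in_chart A w c (cmap c p) v != 0 by rewrite Ev.
have cv : {for cmap c p, continuous (fun y => form_in_chart A w c y v)}.
  by apply: Ck_continuous (sw c Ac v 0%N) _; exact: cimg_cmap.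
have cm : {for p, continuous (cmap c)} by have [[_ _ h _] _] := hc; exact: h.
have N : \forall x \near p, form_in_chart A w c (cmap c x) v != 0.
  have cc : {for p, continuous ((fun y => form_in_chart A w c y v) \o cmap c)}.
    exact: continuous_comp cm cv.
  apply: (cc [set r : R | r != 0]).
  by apply: open_nbhs_nbhs; split => //; exact: open_neq.
have {}N : nbhs p (cdom c `&` [set x | form_in_chart A w c (cmap c x) v != 0]).
  by apply: filterI => //; apply: open_nbhs_nbhs; split => //; exact: chart_open.
exists v, (interior (cdom c `&` [set x | form_in_chart A w c (cmap c x) v != 0])).
split; [exact: open_interior|by []|by move=> x /interior_subset[]|].
move=> y /(cimgP _ _ hc)[_ /interior_subset[_ h] yE].
by move: h; rewrite /= yE.
Qed.

(* In a chart, [f] is the quotient of the values of [w'] and [w] on a constant field on which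
   [w] does not vanish. *)
Lemma smooth_fun_form_ratio w w' (f : T -> R) : smooth_form A w -> smooth_form A w' ->
  (forall p, exists u, w p u != 0) -> (forall p u, w' p u = f p * w p u) ->
  smooth_fun A f.
Proof.
move=> sw sw' w0 E c Ac k; have hc := mfd_chart mA Ac.
apply: Ck_near => y yc; have [cy Ey] := (cimgTP _ hc).1 yc.
have [v [V [oV Vy Vc v0]]] := form_factor_local sw Ac cy (w0 _).
have sub : cimg c V `<=` cimg c setT by exact: cimg_sub.
exists (fun y => form_in_chart A w' c y v * (form_in_chart A w c y v)^-1), (cimg c V).
split; first exact: open_cimg.
- by rewrite -Ey; exact: cimg_cmap.
- apply: CkM; first exact: open_cimg.
    exact: CkS sub (sw'.2 c Ac v k).
  by apply: CkV => //; [exact: open_cimg|exact: CkS sub (sw.2 c Ac v k)].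
- move=> z Vz; rewrite /form_in_chart E mulfK//.
  exact: v0.
Qed.

End FormFactors.

Section JointConformalFactor.
Context {R : realType} {S T : topologicalType} {m n : nat}.
Context (B : atlas R S m) (A : atlas R T n).
Hypotheses (mB : smooth_manifold B) (mA : smooth_manifold A).

(* The spatial partial derivative of [F] carries [w] to [f g * w]; in charts this makes [f]
   a quotient of jointly smooth functions. *)
Lemma joint_smooth_factor (F : S -> T -> T) (w : T -> 'rV[R]_n -> R) (f : S -> T -> R) c d :
  smooth_map (prod_atlas B A) A (fun z => F z.1 z.2) ->
  (forall g, smooth_map A A (F g)) ->
  smooth_form A w -> (forall p, exists u, w p u != 0) ->
  (forall g, pullback A (F g) w = (fun x v => f g x * w x v)) ->
  charts B c -> charts A d ->
  smooth_on [set z : 'rV[R]_(m + n) | cimg c setT (lsubmx z) /\ cimg d setT (rsubmx z)]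
    (fun z => f (cinv c (lsubmx z)) (cinv d (rsubmx z))).
Proof.
move=> sF sFg sw w0 E Bc Ad k.
have hc := mfd_chart mB Bc; have hd := mfd_chart mA Ad.
have hcd := is_chart_prod hc hd.
apply: Ck_near => z [zc zd].
have [cg Eg] := (cimgTP _ hc).1 zc; have [dx Ex] := (cimgTP _ hd).1 zd.
set g0 := cinv c _ in cg Eg; set x0 := cinv d _ in dx Ex.
have [v [V [oV Vx Vd v0]]] := form_factor_local mA sw Ad dx (w0 _).
pose d' := chart_at A (F g0 x0).
have Ad' : charts A d' by exact: mfd_chart_at.
have hd' := mfd_chart mA Ad'.
pose W0 := (setT `*` V) `&` ((fun z : S * T => F z.1 z.2) @^-1` cdom d').
pose pc := prod_chart c d.
pose W := cimg pc W0.
have oFd : open ((fun z : S * T => F z.1 z.2) @^-1` cdom d').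
  by have /continuousP := sF.1; apply; exact: chart_open.
have oW : open W.
  apply: open_cimg => //; apply: openI => //.
  rewrite setTX.
  have c2 : continuous (@snd S T) by move=> ?; exact: cvg_snd.
  by move/continuousP: c2; apply.
have PW y : W y -> [/\ cdom c (cinv c (lsubmx y)), cdom d (cinv d (rsubmx y)),
    V (cinv d (rsubmx y)), cdom d' (F (cinv c (lsubmx y)) (cinv d (rsubmx y))) &
    cmap d (cinv d (rsubmx y)) = rsubmx y].
  move=> /(cimgP _ _ hcd)[[/= h1 h2] [[_ /= h3] /= h4]] /= /eqP.
  by rewrite -[X in _ == X]hsubmxK => /eqP/eq_row_mx[_ h5].
pose H := cmap d' \o (fun z : S * T => F z.1 z.2) \o cinv pc.
have sH j : Ck j W H.
  have [_ sF2] := sF.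
  apply: CkS (sF2 pc d' _ Ad' j); first by apply: cimg_sub => q [].
  by exists c, d.
pose W' j y := form_in_chart A w d' y (delta_mx 0 j).
(* A smooth form is smooth in the base point for a fixed vector only, whereas here the vector varies
   with [y]. It is expanded in coordinates, so that only fixed basis vectors are inserted into the
   form. *)
pose num y := \sum_j 'D_(row_mx 0 v) H y 0 j * W' j (H y).
exists (fun y => num y * (form_in_chart A w d (rsubmx y) v)^-1), W; split => //.
- apply/(cimgP _ _ hcd); rewrite /= -/g0 -/x0; split => //.
    by split => //=; exact: mfd_cdom_at.
  by rewrite Eg Ex hsubmxK.
- apply: CkM => //.
    apply: Ck_sum => // j; apply: CkM => //.
      by apply: (Ck_coord j oW); exact: Ck_derive (sH k.+1).
    apply: (@Ck_comp _ _ _ _ _ (cimg d' setT) (W' j) H) => //.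
    + exact: open_cimgT.
    + by move=> y /PW[_ _ _ h _]; exact: cimg_cmap.
    + exact: sw.2.
  apply: CkV => //.
    move=> y /PW[_ h1 h2 _ h3]; rewrite -h3; apply: v0.
    by exists (cinv d (rsubmx y)).
  apply: (@Ck_comp _ _ _ _ _ (cimg d setT) (fun y => form_in_chart A w d y v)
    (@rsubmx R 1 m n)) => //.
  + exact: open_cimgT.
  + by move=> y /PW[_ h1 _ _ h3]; rewrite -h3; exact: cimg_cmap.
  + exact: sw.2.
  + exact: Ck_rsubmx.
move=> y Wy; have [h1 h2 h3 h4 h5] := PW y Wy.
set g := cinv c (lsubmx y); set x := cinv d (rsubmx y).
have nz : form_in_chart A w d (rsubmx y) v != 0.
  by rewrite -h5; apply: v0; exists x.
apply: (mulIf nz); rewrite mulfVK//.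
(* Freezing the first coordinates turns [H] into the chart expression of [F g], so its derivative in
   direction [row_mx 0 v] is the spatial derivative that occurs in the pullback. *)
have HE : (fun y' => H (row_mx (lsubmx y) y')) = cmap d' \o F g \o cinv d.
  by apply/funext => y'; rewrite /H /= row_mxKl row_mxKr.
have DE : 'D_v (cmap d' \o F g \o cinv d) (rsubmx y) = 'D_(row_mx 0 v) H y.
  by rewrite -HE derive_row_mxr hsubmxK.
have := form_in_chart_pullback mA w v (sFg g) Ad Ad' h2 h4.
rewrite E [LHS]/form_in_chart (chart_cinvK hd h2) -/x => pb.
rewrite -{1}h5 (form_in_chartE mA w v Ad h2) pb h5 DE.
rewrite (form_in_chart_sum mA _ Ad' _ sw.1); last exact: cimg_cmap.
by [].
Qed.

End JointConformalFactor.

(** * Conformal change of a contact form *)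

Section SignedSums.
Context {R : comNzRingType} {m : nat} {V : Type}.

(** This is [a /\ a = - (a /\ a)]: precomposing with the transposition of [0] and [q] exchanges the
    two factors [a], fixes [g] and reverses the signature. *)
Lemma alternating_swap0 (a : V -> R) (g : 'S_m.*2.+1 -> R) (e : 'I_m.*2.+1 -> V)
    (q : 'I_m.*2.+1) :
  q != ord0 -> (forall s, g (tperm ord0 q * s)%g = g s) ->
  \sum_(s : 'S_m.*2.+1) (-1) ^+ s * (a (e (s ord0)) * a (e (s q)) * g s) =
  - (\sum_(s : 'S_m.*2.+1) (-1) ^+ s * (a (e (s ord0)) * a (e (s q)) * g s)).
Proof.
move=> q0 gE.
rewrite {1}(reindex_inj (mulgI (tperm ord0 q))) /= -sumrN.
apply: eq_bigr => s _.
rewrite odd_mul_tperm gE !permM tpermL tpermR eq_sym q0 signr_addb mulN1r mulNr.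
by rewrite [a (e (s q)) * _]mulrC.
Qed.

End SignedSums.

Section ContactVolume.
Context {R : realFieldType} {m : nat} {V : Type}.
Local Notation N := m.*2.+1.

(* [contact_volume A w p] is [wedge_volume (w p) (fun=> ext_deriv A w p)]; indexing the factors
   by [i] allows replacing them one at a time. *)
Definition wedge_volume (a : V -> R) (b : 'I_m -> V -> V -> R) (e : 'I_N -> V) : R :=
  \sum_(s : 'S_N) (-1) ^+ s * a (e (s ord0)) *
    \prod_(i < m) b i (e (s (inord i.*2.+1))) (e (s (inord i.*2.+2))).

Lemma alternating_sum0 (a : V -> R) (g : 'S_N -> R) (e : 'I_N -> V) (q : 'I_N) :
  q != ord0 -> (forall s, g (tperm ord0 q * s)%g = g s) ->
  \sum_(s : 'S_N) (-1) ^+ s * (a (e (s ord0)) * a (e (s q)) * g s) = 0.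
Proof.
move=> q0 gE; have /eqP := alternating_swap0 a e q0 gE.
by rewrite -addr_eq0 -mulr2n mulrn_eq0 => /eqP.
Qed.

(* A factor [c b + g /\ a] may be replaced by [c b], since [a /\ a = 0]. *)
Lemma wedge_volume_step (a g : V -> R) (b b' : 'I_m -> V -> V -> R) (c : R) (k : 'I_m)
    (e : 'I_N -> V) :
  (forall i, i != k -> b' i = b i) ->
  (forall x y, b' k x y = c * b k x y + (g x * a y - g y * a x)) ->
  wedge_volume a b' e = c * wedge_volume a b e.
Proof.
move=> bE bk; rewrite /wedge_volume mulr_sumr.
pose p : 'I_N := inord k.*2.+1; pose q : 'I_N := inord k.*2.+2.
have km : (k.*2.+2 < N)%N by rewrite ltnS -doubleS leq_double.
have vp : p = k.*2.+1 :> nat by rewrite /p inordK// (ltn_trans _ km).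
have vq : q = k.*2.+2 :> nat by rewrite /q inordK.
pose rest (s : 'S_N) := \prod_(i < m | i != k) b i (e (s (inord i.*2.+1))) (e (s (inord i.*2.+2))).
have vi (i : 'I_m) : (i.*2.+2 < N)%N by rewrite ltnS -doubleS leq_double.
(* The slots [2 i + 1] and [2 i + 2] of a factor [i != k] avoid [p] and [q], and by [neq0] also [0].
   Hence [rest] is unchanged by the transposition of [0] with [p] or [q]. *)
have neq1 (i : 'I_m) (r : 'I_N) : i != k -> r = p \/ r = q ->
   (inord i.*2.+1 != r :> 'I_N) && (inord i.*2.+2 != r :> 'I_N).
  move=> ik rE; have ik' : (i : nat) <> k by move=> h; case/eqP: ik; exact: val_inj.
  have h1 : (inord i.*2.+1 : 'I_N) = i.*2.+1 :> nat by rewrite inordK// (ltn_trans _ (vi i)).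
  have h2 : (inord i.*2.+2 : 'I_N) = i.*2.+2 :> nat by rewrite inordK.
  have {}rE : ((r : nat) == k.*2.+1) || ((r : nat) == k.*2.+2).
    by case: rE => ->; rewrite ?vp ?vq eqxx ?orbT.
  by apply/andP; split; apply/eqP => /(congr1 (@nat_of_ord _)); rewrite ?h1 ?h2;
    case/orP: rE => /eqP ->; move: ik'; lia.
have neq0 (i : 'I_m) : (inord i.*2.+1 != ord0 :> 'I_N) && (inord i.*2.+2 != ord0 :> 'I_N).
  have h1 : (inord i.*2.+1 : 'I_N) = i.*2.+1 :> nat by rewrite inordK// (ltn_trans _ (vi i)).
  have h2 : (inord i.*2.+2 : 'I_N) = i.*2.+2 :> nat by rewrite inordK.
  by apply/andP; split; apply/eqP => /(congr1 (@nat_of_ord _)); rewrite ?h1 ?h2.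
have restE r s : r = p \/ r = q -> rest (tperm ord0 r * s)%g = rest s.
  move=> rE; apply: eq_bigr => i ik.
  have /andP[h1 h2] := neq1 i r ik rE; have /andP[h3 h4] := neq0 i.
  by rewrite !permM !tpermD// eq_sym.
have p0 : p != ord0 by have /andP[] := neq0 k.
have q0 : q != ord0 by have /andP[] := neq0 k.
have pq : p != q by apply/eqP => /(congr1 (@nat_of_ord _)); rewrite vp vq; lia.
(* The two halves of [g /\ a] in factor [k] put the second [a] at slot [q] or at slot [p]; each is
   cancelled by the transposition of that slot with [0]. *)
have S1 : \sum_(s : 'S_N) (-1) ^+ s * (a (e (s ord0)) * a (e (s q)) * (g (e (s p)) * rest s)) = 0.
  apply: (@alternating_sum0 a (fun s => g (e (s p)) * rest s) e q) => // s.
  rewrite restE; last by right.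
  by rewrite permM tpermD// eq_sym.
have S2 : \sum_(s : 'S_N) (-1) ^+ s * (a (e (s ord0)) * a (e (s p)) * (g (e (s q)) * rest s)) = 0.
  apply: (@alternating_sum0 a (fun s => g (e (s q)) * rest s) e p) => // s.
  rewrite restE; last by left.
  by rewrite permM tpermD// eq_sym.
pose T1 (s : 'S_N) := (-1) ^+ s * (a (e (s ord0)) * a (e (s q)) * (g (e (s p)) * rest s)).
pose T2 (s : 'S_N) := (-1) ^+ s * (a (e (s ord0)) * a (e (s p)) * (g (e (s q)) * rest s)).
transitivity (\sum_(s : 'S_N) (c * ((-1) ^+ s * a (e (s ord0)) *
    \prod_(i < m) b i (e (s (inord i.*2.+1))) (e (s (inord i.*2.+2)))) + (T1 s - T2 s)));
  last by rewrite big_split/= sumrB S1 S2 subrr addr0.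
apply: eq_bigr => s _.
rewrite (bigD1 k)//= (bigD1 k (P := xpredT))//= bk -/p -/q.
rewrite (eq_bigr (fun i => b i (e (s (inord i.*2.+1))) (e (s (inord i.*2.+2))))); last first.
  by move=> i ik; rewrite bE.
rewrite -/(rest s) /T1 /T2.
move: (rest s) ((-1) ^+ s : R) (a (e (s ord0))) (a (e (s p))) (a (e (s q))) (g (e (s p)))
  (g (e (s q))) (b k (e (s p)) (e (s q))) => r0 sg a0 ap aq gp gq bpq.
ring.
Qed.

Lemma wedge_volume_scale (a g : V -> R) (b b' : V -> V -> R) (c : R) (e : 'I_N -> V) :
  (forall x y, b' x y = c * b x y + (g x * a y - g y * a x)) ->
  wedge_volume a (fun=> b') e = c ^+ m * wedge_volume a (fun=> b) e.
Proof.
move=> bE.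
(* The first [k] factors have been changed from [b'] to [b], each at the cost of one [c]. *)
have H k : (k <= m)%N -> wedge_volume a (fun=> b') e =
    c ^+ k * wedge_volume a (fun i : 'I_m => if (i < k)%N then b else b') e.
  elim: k => [|k IH] km; first by rewrite expr0 mul1r.
  rewrite IH; last exact: ltnW.
  rewrite exprSr -mulrA; congr (_ * _).
  apply: (@wedge_volume_step a g _ _ c (Ordinal km)).
    move=> i ik; rewrite ltnS [(i <= k)%N]leq_eqVlt.
    by rewrite (negbTE (_ : (i : nat) != k)).
  by move=> x y; rewrite /= ltnn ltnSn.
rewrite (H m (leqnn m)); congr (_ * _); rewrite /wedge_volume.
apply: eq_bigr => s _; congr (_ * _); apply: eq_bigr => i _.
by rewrite ltn_ord.
Qed.

Lemma wedge_volume_scalel (a : V -> R) (b : 'I_m -> V -> V -> R) (c : R) (e : 'I_N -> V) :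
  wedge_volume (fun x => c * a x) b e = c * wedge_volume a b e.
Proof.
rewrite /wedge_volume mulr_sumr; apply: eq_bigr => s _.
by rewrite [_ * (c * _)]mulrCA -[LHS]mulrA.
Qed.

End ContactVolume.

(** * Multiplying a contact form by a function *)

Section ConformalChange.
Context {R : realType} {M : topologicalType} {m : nat} (A : atlas R M m.*2.+1).
Hypothesis mA : smooth_manifold A.
Implicit Types (w : M -> 'rV[R]_(m.*2.+1) -> R) (f : M -> R).

(** Leibniz rule [d (f w) = f dw + df /\ w], computed in the chart chosen at [p], where the chart
    expression of [w] at [p] is [w p] itself. *)
Lemma ext_deriv_scale w f p u v : smooth_form A w -> smooth_fun A f ->
  ext_deriv A (fun p v => f p * w p v) p u v =
  f p * ext_deriv A w p u v +
    ('D_u (f \o cinv (chart_at A p)) (cmap (chart_at A p) p) * w p v -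
     'D_v (f \o cinv (chart_at A p)) (cmap (chart_at A p) p) * w p u).
Proof.
move=> [_ sw] sf; rewrite /ext_deriv /=.
set c := chart_at A p; set y := cmap c p.
have Ac : charts A c by exact: mfd_chart_at.
have cp : cdom c p by exact: mfd_cdom_at.
have yc : cimg c setT y by exact: cimg_cmap.
have df x : derivable (f \o cinv c) y x by exact: Ck_derivable (sf c Ac 1%N) yc.
have dw x z : derivable (fun y => form_in_chart A w c y z) y x.
  exact: Ck_derivable (sw c Ac z 1%N) yc.
have E x z : 'D_x (fun y => form_in_chart A (fun p v => f p * w p v) c y z) y =
    f p * 'D_x (fun y => form_in_chart A w c y z) y + w p z * 'D_x (f \o cinv c) y.
  have -> : (fun y => form_in_chart A (fun p v => f p * w p v) c y z) =
     (f \o cinv c) * (fun y => form_in_chart A w c y z) by [].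
  rewrite deriveM//; congr (_ * _ + _ * _).
    by rewrite /= /y (chart_cinvK (mfd_chart mA Ac) cp).
  exact: form_in_chart_at.
rewrite (E u v) (E v u).
move: ('D_u (fun y => form_in_chart A w c y v) y) ('D_v (fun y => form_in_chart A w c y u) y)
  ('D_u (f \o cinv c) y) ('D_v (f \o cinv c) y) (f p) (w p u) (w p v) => d1 d2 d3 d4 fp wu wv.
ring.
Qed.

Lemma smooth_form_scale w f : smooth_form A w -> smooth_fun A f ->
  smooth_form A (fun p v => f p * w p v).
Proof.
move=> [lw sw] sf; split; first by move=> p a u v; rewrite lw; ring.
move=> c Ac v k; apply: (@CkM _ _ _ _ (f \o cinv c) (fun y => form_in_chart A w c y v)).
- exact: open_cimgT (mfd_chart mA Ac).
- exact: sf.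
- exact: sw.
Qed.

Lemma contact_form_scale w f : contact_form A w -> smooth_fun A f ->
  (forall p, f p != 0) -> contact_form A (fun p v => f p * w p v).
Proof.
move=> [sw vw] sf f0; split; first exact: smooth_form_scale.
move=> p; have [e e0] := vw p; exists e.
have -> : contact_volume A (fun p v => f p * w p v) p e =
  wedge_volume (fun v => f p * w p v)
    (fun=> ext_deriv A (fun p v => f p * w p v) p) e by [].
(* The one-form contributes one factor [f p] and the two-forms contribute [m]. The auxiliary
   function [g] is the differential of [f] at [p]. *)
rewrite wedge_volume_scalel (@wedge_volume_scale _ _ _ (w p)
  (fun u => 'D_u (f \o cinv (chart_at A p)) (cmap (chart_at A p) p)) (ext_deriv A w p) _ (f p)).
  by rewrite !mulf_neq0 ?expf_neq0.
by move=> x y; rewrite ext_deriv_scale.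
Qed.

(** Every term of the contact volume contains a value of [w p]. *)
Lemma contact_form_neq0 w p : contact_form A w -> exists u, w p u != 0.
Proof.
move=> [_ /(_ p)[e e0]]; apply: contrapT => h.
have w0 u : w p u = 0 by apply/eqP; apply: contrapT => /negP hu; apply: h; exists u.
case/eqP: e0; rewrite /contact_volume big1// => s _.
by rewrite w0 mulr0 mul0r.
Qed.

Lemma compatible_scale D J w f : compatible A D J w -> smooth_fun A f ->
  (forall p, 0 < f p) -> compatible A D J (fun p v => f p * w p v).
Proof.
move=> [[cw cJ hw] wD] sf f0.
have f1 p : f p != 0 by rewrite gt_eqF.
have kE : ker_form (fun p v => f p * w p v) = ker_form w.
  apply/funext => p; apply/seteqP; split=> v; rewrite /ker_form /=.
    by move=> /eqP; rewrite mulf_eq0 (negbTE (f1 p)) => /eqP.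
  by move=> ->; rewrite mulr0.
split; last by move=> p; rewrite kE.
split; [exact: contact_form_scale|by rewrite kE|].
move=> p; rewrite kE; have [h1 h2 h3] := hw p.
have [Jk _ _ _] := cJ.
(* Both [J p u] and [v] are killed by [w p], so the term [df /\ w] of the Leibniz rule vanishes. *)
have E u v : ker_form w p u -> ker_form w p v ->
    ext_deriv A (fun p v => f p * w p v) p (J p u) v = f p * ext_deriv A w p (J p u) v.
  move=> ku kv; rewrite ext_deriv_scale//; last exact: cw.1.
  have := Jk p u ku; rewrite /ker_form /= => ->.
  by move: kv; rewrite /ker_form /= => ->; rewrite !mulr0 subr0 addr0.
split=> [u v ku kv|u v ku kv|u ku u0].
- by rewrite (E _ _ ku kv) (E _ _ kv ku) (h1 _ _ ku kv).
- by rewrite (E _ _ (Jk _ _ ku) (Jk _ _ kv)) (E _ _ ku kv) (h2 _ _ ku kv).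
- by rewrite (E _ _ ku ku) mulr_gt0 ?h3.
Qed.

End ConformalChange.

(** * Cocycles of smooth functions *)

Section PositiveFunctions.
Context {R : realType} {M : topologicalType} {n : nat} (A : atlas R M n).
Hypothesis mA : smooth_manifold A.
Implicit Types (f g : M -> R).

Lemma smooth_fun_cst (r : R) : smooth_fun A (fun=> r).
Proof. by move=> c Ac k; exact: Ck_cst. Qed.

Lemma smooth_funM f g : smooth_fun A f -> smooth_fun A g -> smooth_fun A (fun x => f x * g x).
Proof.
move=> sf sg c Ac k.
exact: (CkM (open_cimgT (mfd_chart mA Ac)) (sf c Ac k) (sg c Ac k)).
Qed.

Lemma smooth_funV f : (forall x, f x != 0) -> smooth_fun A f -> smooth_fun A (fun x => (f x)^-1).
Proof.
move=> f0 sf c Ac k.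
by apply: (CkV (open_cimgT (mfd_chart mA Ac)) _ (sf c Ac k)) => y _; exact: f0.
Qed.

Lemma smooth_fun_norm f : (forall x, f x != 0) -> smooth_fun A f -> smooth_fun A (fun x => `|f x|).
Proof.
move=> f0 sf c Ac k.
by apply: (Ck_norm (open_cimgT (mfd_chart mA Ac)) _ (sf c Ac k)) => y _; exact: f0.
Qed.

Lemma positive_smooth_cst1 : positive_smooth_fun A (fun=> 1).
Proof. by split; [exact: smooth_fun_cst|move=> x; exact: ltr01]. Qed.

Lemma positive_smoothM f g : positive_smooth_fun A f -> positive_smooth_fun A g ->
  positive_smooth_fun A (fun x => f x * g x).
Proof.
by move=> [sf f0] [sg g0]; split; [exact: smooth_funM|move=> x; rewrite mulr_gt0].
Qed.

Lemma positive_smoothV f : positive_smooth_fun A f -> positive_smooth_fun A (fun x => (f x)^-1).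
Proof.
move=> [sf f0]; split; last by move=> x; rewrite invr_gt0.
by apply: smooth_funV => // x; rewrite gt_eqF.
Qed.

End PositiveFunctions.

(** * Functions smooth jointly in the group element and the point *)

Section JointComposition.
Context {R : realType} {S T : topologicalType} {m n : nat}.
Context (B : atlas R S m) (A : atlas R T n).
Hypotheses (mB : smooth_manifold B) (mA : smooth_manifold A).

(** The link between calculus in finitely many variables and [smooth_into_Cinfty]: it is stable
    under products, inverses and logarithms, and can be checked in product charts. *)
Definition jointly_smooth (f : S -> T -> R) : Prop := forall c d, charts B c -> charts A d ->
  smooth_on [set z : 'rV[R]_(m + n) | cimg c setT (lsubmx z) /\ cimg d setT (rsubmx z)]
    (fun z => f (cinv c (lsubmx z)) (cinv d (rsubmx z))).

Lemma open_joint_domain c d : charts B c -> charts A d ->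
  open [set z : 'rV[R]_(m + n) | cimg c setT (lsubmx z) /\ cimg d setT (rsubmx z)].
Proof.
move=> Bc Ad; apply: openI.
  by have /continuousP/(_ _ (open_cimgT (mfd_chart mB Bc))) := @continuous_lsubmx R m n.
by have /continuousP/(_ _ (open_cimgT (mfd_chart mA Ad))) := @continuous_rsubmx R m n.
Qed.

Lemma jointly_smooth_comp (F : S -> T -> T) (v : T -> R) :
  smooth_map (prod_atlas B A) A (fun z => F z.1 z.2) -> smooth_fun A v ->
  jointly_smooth (fun g x => v (F g x)).
Proof.
move=> sF sv c d Bc Ad k.
have hc := mfd_chart mB Bc; have hd := mfd_chart mA Ad.
have hcd := is_chart_prod hc hd.
apply: Ck_near => z [zc zd].
have [cg Eg] := (cimgTP _ hc).1 zc; have [dx Ex] := (cimgTP _ hd).1 zd.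
pose d' := chart_at A (F (cinv c (lsubmx z)) (cinv d (rsubmx z))).
have Ad' : charts A d' by exact: mfd_chart_at.
have hd' := mfd_chart mA Ad'.
pose pc := prod_chart c d.
pose W := cimg pc ((fun z : S * T => F z.1 z.2) @^-1` cdom d').
have oW : open W.
  apply: open_cimg => //.
  by have /continuousP := sF.1; apply; exact: chart_open.
have sH : Ck k W (cmap d' \o (fun z : S * T => F z.1 z.2) \o cinv pc).
  by have [_ sF2] := sF; apply: sF2 => //; exists c, d.
exists ((v \o cinv d') \o (cmap d' \o (fun z : S * T => F z.1 z.2) \o cinv pc)), W.
split => //.
- apply/(cimgP _ _ hcd); rewrite /=; split => //; first exact: mfd_cdom_at.
  by rewrite Eg Ex hsubmxK.
- apply: (@Ck_comp _ _ _ _ _ (cimg d' setT) (v \o cinv d') _) => //.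
  + exact: open_cimgT.
  + by move=> y /(cimgP _ _ hcd)[_ h _]; exact: cimg_cmap.
  + exact: sv.
- by move=> y /(cimgP _ _ hcd)[_ h _] /=; rewrite chart_cinvK.
Qed.

Lemma jointly_smooth_snd (v : T -> R) : smooth_fun A v -> jointly_smooth (fun _ x => v x).
Proof.
move=> sv c d Bc Ad k; have oW := open_joint_domain Bc Ad.
have -> : (fun z : 'rV[R]_(m + n) => v (cinv d (rsubmx z))) =
  (v \o cinv d) \o @rsubmx R 1 m n by [].
apply: (@Ck_comp _ _ _ _ _ (cimg d setT)) => //.
- exact: open_cimgT (mfd_chart mA Ad).
- by move=> z [].
- exact: sv.
- exact: Ck_rsubmx.
Qed.

Lemma jointly_smoothM f g : jointly_smooth f -> jointly_smooth g ->
  jointly_smooth (fun s x => f s x * g s x).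
Proof.
move=> sf sg c d Bc Ad k.
exact: (CkM (open_joint_domain Bc Ad) (sf c d Bc Ad k) (sg c d Bc Ad k)).
Qed.

Lemma jointly_smoothV f : (forall s x, f s x != 0) -> jointly_smooth f ->
  jointly_smooth (fun s x => (f s x)^-1).
Proof.
move=> f0 sf c d Bc Ad k.
by apply: (CkV (open_joint_domain Bc Ad) _ (sf c d Bc Ad k)) => z _; exact: f0.
Qed.

Lemma jointly_smooth_ln f : (forall s x, 0 < f s x) -> jointly_smooth f ->
  jointly_smooth (fun s x => ln (f s x)).
Proof.
move=> f0 sf c d Bc Ad k.
by apply: (Ck_ln (open_joint_domain Bc Ad) _ (sf c d Bc Ad k)) => z _; exact: f0.
Qed.

Lemma jointly_smooth_fun f s : jointly_smooth f -> smooth_fun A (f s).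
Proof.
move=> sf d Ad k.
have Bc := mfd_chart_at mB s; have cs := mfd_cdom_at mB s.
have hc := mfd_chart mB Bc.
have := @Ck_slice _ _ _ _ _ _ (cimg d setT) (cmap (chart_at B s) s) _ _ (sf _ d Bc Ad k).
rewrite (_ : (fun y => _) = f s \o cinv d); last first.
  by apply/funext => y; rewrite row_mxKl row_mxKr chart_cinvK.
apply=> y dy; rewrite /= row_mxKl row_mxKr; split => //.
exact: cimg_cmap.
Qed.

Lemma jointly_smooth_into_Cinfty f : jointly_smooth f -> smooth_into_Cinfty B A f.
Proof.
move=> sf c Bc k; apply: Cinfty_Ck_joint; first exact: open_cimgT (mfd_chart mB Bc).
  by move=> d Ad; exact: open_cimgT (mfd_chart mA Ad).
by move=> d Ad; exact: sf.
Qed.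

End JointComposition.

(** * Cocycles, coboundaries and the class of the conformal factor *)

Section Cocycles.
Context {R : realType} {G : topCarrierGroupType} {M : topologicalType} {k n : nat}.
Context (AG : atlas R G k) (AM : atlas R M n) (act : G -> M -> M).
Hypotheses (mG : smooth_manifold AG) (mM : smooth_manifold AM).
Hypothesis act1 : forall x, act 1%g x = x.
Hypothesis actM : forall g h x, act (g * h)%g x = act g (act h x).
Hypothesis act_smooth : forall g, smooth_map AM AM (act g).
Hypothesis actV_smooth :
  smooth_map (prod_atlas AG AM) AM (fun z : G * M => act z.1^-1%g z.2).
Implicit Types (l : G -> M -> R) (v f : M -> R) (w : M -> 'rV[R]_n -> R) (u : G -> M -> R).

Lemma actK g x : act g^-1%g (act g x) = x.
Proof. by rewrite -actM mulVg act1. Qed.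

Lemma actVK g x : act g (act g^-1%g x) = x.
Proof. by rewrite -actM mulgV act1. Qed.

Definition coboundary v : G -> M -> R := fun g x => v (act g^-1%g x) * (v x)^-1.

Lemma Z1d_jointly_smooth l : (forall g x, 0 < l g x) -> jointly_smooth AG AM l ->
  (forall g h x, l (g * h)%g x = l h (act g^-1%g x) * l g x) -> Z1d AG AM act l.
Proof.
move=> l0 sl lM; split=> // [g|].
  by split; [exact: jointly_smooth_fun sl|exact: l0].
exact: (jointly_smooth_into_Cinfty mG mM (jointly_smooth_ln mG mM l0 sl)).
Qed.

Lemma coboundary_gt0 v g x : positive_smooth_fun AM v -> 0 < coboundary v g x.
Proof. by move=> [_ v0]; rewrite mulr_gt0 ?invr_gt0. Qed.

(** Differentiability comes from the joint smoothness of [(g, x) |-> g^-1 x]; in the cocycle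
    identity the intermediate value of [v] at [g^-1 x] cancels. *)
Lemma coboundary_Z1d v : positive_smooth_fun AM v -> Z1d AG AM act (coboundary v).
Proof.
move=> pv; have [sv v0] := pv; have vn x : v x != 0 by rewrite gt_eqF.
apply: Z1d_jointly_smooth.
- by move=> g x; exact: coboundary_gt0.
- apply: (jointly_smoothM mG mM).
    exact: (jointly_smooth_comp mG mM (F := fun g x => act g^-1%g x) actV_smooth sv).
  by apply: (jointly_smooth_snd mG mM); exact: smooth_funV.
- move=> g h x; rewrite /coboundary invgM actM.
  by rewrite mulrA mulfVK.
Qed.

Lemma B1d_coboundary v : positive_smooth_fun AM v -> B1d AG AM act (coboundary v).
Proof. by move=> pv; split; [exact: coboundary_Z1d|exists v]. Qed.

Lemma coboundary1 : coboundary (fun=> 1) = fun _ _ => 1.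
Proof. by apply/funext => g; apply/funext => x; rewrite /coboundary invr1 mulr1. Qed.

(** The cocycle condition inside [B1d] is automatic for coboundaries of positive smooth functions,
    so a coset is described by the functions [v] alone. *)
Lemma H1d_classP l l' : H1d_class AG AM act l l' <->
  exists2 v, positive_smooth_fun AM v & l' = fun g x => l g x * coboundary v g x.
Proof.
split=> [[b [_ [v pv ->]] ->]|[v pv ->]]; first by exists v.
by exists (coboundary v) => //; exact: B1d_coboundary.
Qed.

(** [coboundary] is multiplicative in its function: passing between the two cosets multiplies the
    witness by [v] or by its inverse. *)
Lemma H1d_class_coboundary l v : positive_smooth_fun AM v ->
  H1d_class AG AM act (fun g x => l g x * coboundary v g x) = H1d_class AG AM act l.
Proof.
move=> pv; have [_ v0] := pv; have vn x : v x != 0 by rewrite gt_eqF.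
apply/seteqP; split=> l' /H1d_classP[v' pv' ->]; apply/H1d_classP.
  exists (fun x => v x * v' x); first exact: positive_smoothM.
  apply/funext => g; apply/funext => x; rewrite /coboundary invfM -!mulrA; congr (_ * (_ * _)).
  by rewrite mulrCA.
exists (fun x => (v x)^-1 * v' x).
  by apply: positive_smoothM => //; exact: positive_smoothV.
apply/funext => g; apply/funext => x; rewrite /coboundary -mulrA; congr (_ * _).
have [_ v'0] := pv'; have vn' : v' x != 0 by rewrite gt_eqF.
by field; rewrite !vn vn'.
Qed.

Lemma H1d_class_zeroP l : H1d_class AG AM act l = H1d_zero AG AM act ->
  exists2 v, positive_smooth_fun AM v & l = coboundary v.
Proof.
move=> E; have : H1d_class AG AM act l l.
  apply/H1d_classP; exists (fun=> 1); first exact: positive_smooth_cst1.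
  by rewrite coboundary1; apply/funext => g; apply/funext => x; rewrite mulr1.
rewrite E => /H1d_classP[v pv ->]; exists v => //.
by apply/funext => g; apply/funext => x; rewrite mul1r.
Qed.

Section ConformalFactors.
Context (w : M -> 'rV[R]_n -> R) (u : G -> M -> R).
Hypotheses (w_smooth : smooth_form AM w) (w_neq0 : forall p, exists X, w p X != 0).
Hypothesis wu : conformal_factor AM act w u.

Lemma conformal_factor_gt0 g x : 0 < u g x.
Proof. by have [[_ h] _] := wu g; exact: h. Qed.

Lemma conformal_factorE g x (X : 'rV[R]_n) :
  w (act g x) (tangent_map AM AM (act g) x X) = u g x * w x X.
Proof. by have [_ E] := wu g; have := congr1 (fun q : M -> 'rV[R]_n -> R => q x X) E. Qed.

Lemma conformal_factorM g h x : u (g * h)%g x = u g (act h x) * u h x.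
Proof.
(* The factor is visible only through its product with values of [w], so the identity is tested on a
   vector where [w] does not vanish. *)
have [v v0] := w_neq0 x; apply: (mulIf v0).
rewrite -conformal_factorE -mulrA -conformal_factorE -conformal_factorE.
have -> : act (g * h)%g = act g \o act h by apply/funext => y; exact: actM.
by rewrite tangent_map_comp.
Qed.

(** The cocycle identity at [1 * 1 = 1] makes the value equal to its square, and it is not zero. *)
Lemma conformal_factor1 x : u 1%g x = 1.
Proof.
have u0 : u 1%g x != 0 by rewrite gt_eqF// conformal_factor_gt0.
apply: (mulIf u0); rewrite mul1r.
by have := conformal_factorM 1%g 1%g x; rewrite mulg1 act1.
Qed.

(** The cocycle identity at [g * g^-1 = 1]. In [u_g (g^-1 x)] the element [g] occurs both as index
    and in the point; the right-hand side involves only the conformal factor of [x |-> g^-1 x], as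
    [joint_smooth_factor] requires. *)
Lemma lambda_CRE g x : lambda_CR act u g x = (u g^-1%g x)^-1.
Proof.
have u0 : u g^-1%g x != 0 by rewrite gt_eqF// conformal_factor_gt0.
by apply: (mulIf u0); rewrite mulVf// -conformal_factorM mulgV conformal_factor1.
Qed.

Lemma lambda_CR_Z1d : Z1d AG AM act (lambda_CR act u).
Proof.
have u0 g x : u g x != 0 by rewrite gt_eqF// conformal_factor_gt0.
apply: Z1d_jointly_smooth.
- by move=> g x; exact: conformal_factor_gt0.
- have -> : lambda_CR act u = fun g x => (u g^-1%g x)^-1.
    by apply/funext => g; apply/funext => x; exact: lambda_CRE.
  apply: (jointly_smoothV mG mM) => // c d Gc Md.
  apply: (@joint_smooth_factor _ _ _ _ _ AG AM mG mM (fun g x => act g^-1%g x) w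
    (fun g x => u g^-1%g x)) => // g.
  by have [_] := wu g^-1%g.
- move=> g h x; rewrite /lambda_CR conformal_factorM invgM actM actVK.
  by rewrite mulrC.
Qed.

End ConformalFactors.

(* Both forms have kernel [D], so [w' = f * w] with [f] nowhere zero; [f] may be negative
   when [D = 0], whence the absolute value. *)
Lemma lambda_CR_class w w' u u' : smooth_form AM w -> smooth_form AM w' ->
  (forall p, exists X, w p X != 0) -> (forall p, ker_form w p = ker_form w' p) ->
  conformal_factor AM act w u -> conformal_factor AM act w' u' ->
  H1d_class AG AM act (lambda_CR act u') = H1d_class AG AM act (lambda_CR act u).
Proof.
move=> sw sw' w0 kE wu wu'.
(* The vectors [e p] are chosen point by point with no regularity; the ratio [f] does not depend on
   the choice and is shown to be smooth afterwards. *)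
pose e p : 'rV[R]_n := xget 0 [set X | w p X != 0].
have e0 p : w p (e p) != 0 by rewrite /e; case: xgetP => // h; have [v v0] := w0 p; case: (h v).
pose f p := w' p (e p) / w p (e p).
have wE p (X : 'rV[R]_n) : w' p X = f p * w p X.
  (* Removing from [X] its component along [e p] leaves a vector of the common kernel, on which [w']
     vanishes too. *)
  have : ker_form w p ((- (w p X / w p (e p))) *: e p + X).
    by rewrite /ker_form /= sw.1 mulNr divfK// addNr.
  rewrite kE /ker_form /= sw'.1 mulNr addrC => /eqP; rewrite subr_eq0 => /eqP ->.
  by rewrite /f mulrAC [RHS]mulrAC [w p X * _]mulrC.
have f0 p : f p != 0.
  rewrite mulf_neq0 ?invr_eq0//; apply/eqP => h.
  by case/eqP: (e0 p); have : ker_form w' p (e p) by []; rewrite -kE.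
have sf : smooth_fun AM f by exact: (smooth_fun_form_ratio mM sw sw' w0 wE).
have psf : positive_smooth_fun AM (fun x => `|f x|^-1).
  split; last by move=> x; rewrite invr_gt0 normr_gt0.
  apply: smooth_funV => //; first by move=> x; rewrite normr_eq0.
  exact: smooth_fun_norm.
rewrite -(H1d_class_coboundary (lambda_CR act u) psf); congr (H1d_class _ _ _ _).
apply/funext => g; apply/funext => x; rewrite /coboundary invrK /lambda_CR.
set y := act g^-1%g x.
have ->  : x = act g y by rewrite actVK.
(* Both sides are the coefficient of [w y] in the pullback of [w' = f w] by [g]. *)
have E : u' g y * f y = f (act g y) * u g y.
  have [v v0] := w0 y; apply: (mulIf v0).
  rewrite -mulrA -wE -(conformal_factorE wu') wE (conformal_factorE wu).
  by rewrite mulrA.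
have nf : `|f y| != 0 by rewrite normr_eq0.
apply: (mulIf nf).
have := congr1 Num.norm E; rewrite (normrM (u' g y)) (normrM (f (act g y))).
rewrite (gtr0_norm (conformal_factor_gt0 wu' g y)) (gtr0_norm (conformal_factor_gt0 wu g y)) => ->.
rewrite mulrC -[RHS]mulrA; congr (_ * _).
by rewrite [RHS]mulrAC (mulVf nf) mul1r.
Qed.

End Cocycles.

(** * The action restricted to a Lie subgroup *)

Section LieActions.
Context {R : realType} {G H : topCarrierGroupType} {M : topologicalType} {k a n : nat}.
Context (AG : atlas R G k) (AH : atlas R H a) (AM : atlas R M n).
Hypothesis mM : smooth_manifold AM.

Lemma prod_atlas_cover (S T : topologicalType) m l (A : atlas R S m) (B : atlas R T l) :
  smooth_manifold A -> smooth_manifold B ->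
  forall z, exists2 e, charts (prod_atlas A B) e & cdom e z.
Proof.
move=> mA mB [x y]; have [c Ac cx] := mfd_cover mA x; have [d Bd dy] := mfd_cover mB y.
by exists (prod_chart c d) => //; exists c, d.
Qed.

(** Cocycles and coboundaries evaluate functions at [g^-1 x], so the inverted action is the one that
    must be smooth. It is inversion followed by [iota] on the first factor, then evaluation. *)
Lemma inverse_action_smooth (ev : H -> M -> M) (iota : G -> H) :
  lie_group AG -> smooth_manifold AH -> smooth_map AG AH iota ->
  smooth_map (prod_atlas AH AM) AM (fun z : H * M => ev z.1 z.2) ->
  smooth_map (prod_atlas AG AM) AM (fun z : G * M => ev (iota z.1^-1%g) z.2).
Proof.
move=> [mG _ sV] mH si sev.
have hG := mfd_chart mG; have hH := mfd_chart mH; have hM := mfd_chart mM.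
have s1 : smooth_map AG AH (iota \o (fun g => g^-1%g)).
  by apply: (smooth_map_comp hG hG hH (mfd_cover mG) sV si).
have s2 := smooth_map_prod hG hM hH hM s1 (smooth_map_id mM).
exact: (smooth_map_comp (prod_atlas_is_chart hG hM) (prod_atlas_is_chart hH hM) hM
  (prod_atlas_cover mH mM) s2 sev).
Qed.

End LieActions.

Theorem proposition26 (R : realType) (m : nat) (M : topologicalType)
    (AM : atlas R M m.*2.+1)
    (D : M -> set 'rV[R]_(m.*2.+1))
    (J : M -> 'rV[R]_(m.*2.+1) -> 'rV[R]_(m.*2.+1))
    (a k : nat) (Aut G : topCarrierGroupType)
    (AAut : atlas R Aut a) (AG : atlas R G k)
    (ev : Aut -> M -> M) (iota : G -> Aut)
    (M_manifold : smooth_manifold AM)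
    (M_connected : connected [set: M])
    (M_CR : strictly_pseudoconvex_CR AM D J)
    (Aut_lie : lie_transformation_group AAut AM (Aut_CR AM D J) ev)
    (G_lie : lie_subgroup AG AAut iota) :
  let act : G -> M -> M := fun g => ev (iota g) in
  let mu_CR := fun u => H1d_class AG AM act (lambda_CR act u) in
  [/\ forall w u, compatible AM D J w -> conformal_factor AM act w u ->
        Z1d AG AM act (lambda_CR act u) /\ H1d AG AM act (mu_CR u),
      forall w w' u u', compatible AM D J w -> compatible AM D J w' ->
        conformal_factor AM act w u -> conformal_factor AM act w' u' ->
        mu_CR u = mu_CR u' &
      forall w u, compatible AM D J w -> conformal_factor AM act w u ->
        mu_CR u = H1d_zero AG AM act <->
        exists2 eta, compatible AM D J eta &
          forall g : G, Psh AM eta J (act g)].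
Proof.
move=> act mu_CR.
have [[mAut _ _] ev_inj ev_range evM ev_smooth] := Aut_lie.
have [lG iotaM iota_inj iota_smooth _] := G_lie.
have mG : smooth_manifold AG by case: lG.
have act_Aut g : Aut_CR AM D J (act g) by rewrite -ev_range; exists (iota g).
have act_diffeo g : diffeo AM (act g) by case: (act_Aut g).
have actM g h x : act (g * h)%g x = act g (act h x) by rewrite /act iotaM evM.
(* Only multiplicativity of the action is given; [act 1] is idempotent and injective, hence the
   identity. *)
have act1 x : act 1%g x = x.
  have [_ [f [_ fK _]]] := act_diffeo 1%g.
  by apply: (can_inj fK); rewrite -actM mulg1.
have act_smooth g : smooth_map AM AM (act g) by case: (act_diffeo g).
have actV_smooth := inverse_action_smooth M_manifold lG mAut iota_smooth ev_smooth.
have sf w : compatible AM D J w -> smooth_form AM w by move=> [[[]]].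
have nz w : compatible AM D J w -> forall p, exists v, w p v != 0.
  by move=> [[cw _ _] _] p; exact: contact_form_neq0 cw.
have lZ w u : compatible AM D J w -> conformal_factor AM act w u ->
    Z1d AG AM act (lambda_CR act u).
  move=> cw.
  exact: (lambda_CR_Z1d mG M_manifold act1 actM act_smooth actV_smooth (sf w cw) (nz w cw)).
have indep w w' u u' : compatible AM D J w -> compatible AM D J w' ->
    conformal_factor AM act w u -> conformal_factor AM act w' u' -> mu_CR u = mu_CR u'.
  move=> cw cw' wu wu'; apply/esym; rewrite /mu_CR.
  have kE p : ker_form w p = ker_form w' p by rewrite cw.2 cw'.2.
  exact: (lambda_CR_class mG M_manifold act1 actM actV_smooth
    (sf w cw) (sf w' cw') (nz w cw) kE wu wu').
split=> [w u cw wu||w u cw wu].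
- by split; [exact: lZ cw wu|exists (lambda_CR act u) => //; exact: lZ cw wu].
- exact: indep.
split=> [zero|[eta ceta psh]].
  have [v pv lE] := H1d_class_zeroP mG M_manifold actM actV_smooth zero.
  have [sv v0] := pv.
  have ceta := compatible_scale M_manifold cw sv v0.
  exists (fun p x => v p * w p x) => // g.
  have [_ _ Jg] := act_Aut g.
  split; first exact: act_diffeo.
    apply/funext => x; apply/funext => y; rewrite /pullback.
    rewrite (conformal_factorE wu).
    (* Evaluated at [g x], the coboundary equation reads [u g x = v x / v (g x)], which is exactly
       the invariance of [v w]. *)
    have := congr1 (fun l => l g (act g x)) lE.
    rewrite /coboundary /lambda_CR (actK act1 actM) => ->.
    by rewrite mulrA mulrCA divff ?mulr1// gt_eqF.
  move=> p y; rewrite (_ : ker_form _ p = D p); first exact: Jg.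
  exact: ceta.2.
(* Since [lambda_CR] of the constant factor [1] is the constant [1], its class is [H1d_zero], and
   independence of the form carries this over to [w]. *)
have eta1 : conformal_factor AM act eta (fun _ _ => 1).
  move=> g; split; first exact: positive_smooth_cst1.
  by have [_ -> _] := psh g; apply/funext => x; apply/funext => v; rewrite mul1r.
by rewrite (indep _ _ _ _ cw ceta wu eta1).
Qed.
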